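(* Let $\xi$ be a random variable with values in $\{0,1,2,\dots\}$ with $\mathbb E\xi=1$ and $0<\operatorname{Var}\xi<\infty$. There exists a constant $C$, depending only on the distribution of $\xi$, such that for all $k\ge 1$ and all $n\ge 1$ with $\mathbb P(|\mathcal T|=n)>0$, $$\mathbb E\, P_k(T_n)\le C\,n\,k .$$
   Context: $\mathcal T$ is the Galton--Watson tree with offspring distribution $\xi$: the random rooted tree which is the family tree of the Galton--Watson process, started with one individual (the root), in which each individual has a number of children distributed as $\xi$, independently. $|\mathcal T|$ is its number of vertices. For $n$ with $\mathbb P(|\mathcal T|=n)>0$, the conditioned Galton--Watson tree $T_n$ is $\mathcal T$ conditioned on $|\mathcal T|=n$. For a rooted tree $\tau$ and $k\ge1$, $P_k(\tau)$ is the number of unordered pairs of vertices $\{v,w\}$ of $\tau$ at graph distance $d(v,w)=k$ (equivalently, the number of paths of length $k$ in $\tau$). *)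

(* Defs.v *)
From HB Require Import structures.
From mathcomp Require Export all_boot all_order all_algebra.
From mathcomp Require Export all_classical all_reals all_analysis.

Set Implicit Arguments.
Unset Strict Implicit.
Unset Printing Implicit Defensive.

Import Order.TTheory GRing.Theory Num.Theory.

Local Open Scope classical_set_scope.
Local Open Scope ring_scope.

(* The graph with vertex set A and, as edges, the pairs of vertices of A
   related by the symmetric relation e. *)
Section graph_distance.
Context {V : eqType}.

Definition walk (e : rel V) (A : set V) (v w : V) (l : nat) : Prop :=
  exists s : seq V,
    [/\ forall x, x \in v :: s -> A x, path e v s, last v s = w & size s = l].

Definition at_distance (e : rel V) (A : set V) (v w : V) (k : nat) : Prop :=
  walk e A v w k /\ forall l, walk e A v w l -> (k <= l)%N.

End graph_distance.

(* Vertices of rooted trees are named by finite words (Ulam-Harris notation):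
   the root is [::] and rcons u i is the i-th child of u, counted from 0. *)
Definition is_child : rel (seq nat) := fun v u =>
  prefix u v && (size v == (size u).+1).

Definition tree_edge : rel (seq nat) := fun u v =>
  is_child u v || is_child v u.

(* The family tree in which the individual u has c u children. *)
Inductive family_tree (c : seq nat -> nat) : set (seq nat) :=
| family_root : family_tree c [::]
| family_child u i :
    family_tree c u -> (i < c u)%N -> family_tree c (rcons u i).

(* P_k, as an extended real so that no convention is needed for infinite
   trees. An unordered pair {v, w} is the set [set v; w]. *)
Definition num_pairs (R : realType) (k : nat) (tau : set (seq nat)) : \bar R :=
  counting [set p : set (seq nat) |
    exists v w, [/\ tau v, tau w, at_distance tree_edge tau v w k
                  & p = [set v; w]]].

Section probability.
Context {R : realType} {d : measure_display} {T : measurableType d}.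

Definition mutually_independent {d' : measure_display}
    {T' : measurableType d'} {I : choiceType} (P : probability T R)
    (X : I -> {RV P >-> T'}) : Prop :=
  forall (s : seq I) (A : I -> set T'), uniq s ->
    (forall i, measurable (A i)) ->
    P (\bigcap_(i in [set` s]) (X i @^-1` A i)) =
    (\prod_(i <- s) P (X i @^-1` A i))%E.

(* E[Y | A] for an event A of positive probability. *)
Definition cond_expectation (P : probability T R) (A : set T)
    (Y : T -> \bar R) : \bar R :=
  ((\int[P]_(w in A) Y w) / P A)%E.

(* The Galton-Watson tree when X u is the number of children that the
   individual u has, or would have if it were born. *)
Definition GW_tree (P : probability T R) (X : seq nat -> {RV P >-> nat})
    (w : T) : set (seq nat) :=
  family_tree (fun u => X u w).

Definition GW_size_event (P : probability T R)
    (X : seq nat -> {RV P >-> nat}) (n : nat) : set T :=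
  [set w | (GW_tree X w #= `I_n)%card].

End probability.

(* Main.v *)
From mathcomp Require Import measurable_realfun zify ring lra.
Require Import Defs.

Set Implicit Arguments.
Unset Strict Implicit.
Unset Printing Implicit Defensive.

Import Order.TTheory GRing.Theory Num.Theory.
Import numFieldNormedType.Exports.

Local Open Scope classical_set_scope.
Local Open Scope nat_scope.

(** Let [p] be the offspring distribution. A tree with [n] vertices is encoded
    by the sequence of its numbers of children in depth-first order, and by
    independence it occurs with probability [weight p d], the product of the
    values of [p] along its code [d]. The claim becomes a bound on finite sums
    over codes.

    A pair of vertices at distance [k] consists of an ancestor and a descendant,
    or of vertices at distances [i] and [j] from their last common ancestor,
    with [i + j = k] and [i, j > 0]. The first kind contributes at most [n]
    pairs. For the second kind the weighted number of pairs does not increase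
    when [i] is replaced by [i - 1] ([total_exchange]): exchange the last common
    ancestor with its child towards the first vertex, each of them keeping its
    other children. This permutes the degrees, so that it preserves the weight;
    it is injective, and it brings the first vertex one step closer to the last
    common ancestor. By symmetry the same holds for [j], so each of the [k - 1]
    choices of [(i, j)] is bounded by the weighted number of pairs of siblings,
    hence by the weighted sum of the squared degrees ([weighted_pairs_le]).

    The cycle lemma ([cycle_lemma]) turns sums over codes of trees into sums
    over all sequences of length [n] and sum [n - 1]. Writing [S_n] for the sum
    of [n] independent variables with distribution [p], it remains to bound the
    expectation of the square of the first summand, on the event
    [S_n = n - 1], by a constant times the probability of that event
    ([head_moment]). This follows from
    [sup_m P(S_n = m) <= c / sqrt n] and, when [S_n = n - 1] is possible at all
    and [n] is large, [P(S_n = n - 1) >= c' / sqrt n].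

    Both local estimates come from fair coins. If [h] is the span, some number
    [r] of summands can add up to [y] and to [y + h]; so a block of [r] summands
    is, with some probability [theta], equal to [y] plus [h] times a fair coin.
    Among [N] blocks about [theta N] contain a coin, by Chebyshev's inequality.
    Conditionally on everything else the coins give a symmetric binomial
    variable, whose point probabilities are at most of order [1 / sqrt N], and
    at least of that order within [O(sqrt N)] of its centre
    ([coin_upper], [coin_lower]); Chebyshev's inequality again shows that the
    value needed lies there with probability bounded below ([block_lower]). *)

(** * Family trees and their depth-first codes *)

Definition word := seq nat.

Lemma family_tree_rconsP (c : word -> nat) (u : word) (i : nat) :
  family_tree c (rcons u i) -> family_tree c u /\ i < c u.
Proof.
move=> H; inversion H as [E|v j Hv ltj E]; first by case: (u) E.
by have [<- <-] := rcons_inj E.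
Qed.

Lemma family_tree_prefix (c : word -> nat) (u s : word) :
  family_tree c (u ++ s) -> family_tree c u.
Proof.
elim/last_ind: s => [|s i IH]; first by rewrite cats0.
by rewrite -rcons_cat => /family_tree_rconsP[/IH].
Qed.

Definition children (u : word) (a : nat) : seq word :=
  [seq rcons u i | i <- iota 0 a].

Lemma mem_children u a v :
  reflect (exists2 i, i < a & v = rcons u i) (v \in children u a).
Proof.
apply: (iffP mapP) => [[i + ->]|[i lti ->]]; last first.
  by exists i => //; rewrite mem_iota.
by rewrite mem_iota => lti; exists i.
Qed.

Lemma size_children u a : size (children u a) = a.
Proof. by rewrite size_map size_iota. Qed.

(** Depth-first exploration: the stack [st] holds the vertices that are discovered
    but not yet visited, and [d] lists the numbers of children in order of visit. *)
Fixpoint nodes (st : seq word) (d : seq nat) : seq word :=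
  match st, d with
  | u :: st', a :: d' => u :: nodes (children u a ++ st') d'
  | _, _ => [::]
  end.

(** The Lukasiewicz condition: the number of discovered but unvisited vertices,
    initially [m], first reaches zero when [d] is used up. Such a [d] encodes a
    forest of [m] trees. *)
Fixpoint forest_code (m : nat) (d : seq nat) : bool :=
  if d is a :: d' then (0 < m) && forest_code (m.-1 + a) d' else m == 0.

Notation tree_nodes d := (nodes [:: [::]] d).

Lemma size_nodes st d : forest_code (size st) d -> size (nodes st d) = size d.
Proof.
elim: d st => [|a d IH] [|u st] //= H.
by rewrite IH // size_cat size_children addnC.
Qed.

Lemma size_tree_nodes d : forest_code 1 d -> size (tree_nodes d) = size d.
Proof. exact: (@size_nodes [:: [::]]). Qed.

Lemma forest_code_sumn m d : forest_code m d -> size d = m + sumn d.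
Proof.
elim: d m => [|a d IH] [|m] //= H; rewrite (IH _ H) /=; lia.
Qed.

Lemma forest_code_stack_sub st d : forest_code (size st) d -> {subset st <= nodes st d}.
Proof.
elim: d st => [|a d IH] [|u st] //= H v; rewrite !inE.
case/orP => [->//|vst]; apply/orP; right.
by apply: IH; rewrite ?mem_cat ?vst ?orbT // size_cat size_children addnC.
Qed.

(** The exploration prescribed by [d] is the one of the family tree of [c]. *)
Definition obeys (c : word -> nat) (st : seq word) (d : seq nat) : Prop :=
  map c (nodes st d) = d.

Lemma obeys_children c st d u i : forest_code (size st) d -> obeys c st d ->
  u \in nodes st d -> i < c u -> rcons u i \in nodes st d.
Proof.
rewrite /obeys.
elim: d st => [|a d IH] [|v st] //= H [ca Hd].
have Hs : forest_code (size (children v a ++ st)) d by rewrite size_cat size_children addnC.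
rewrite !inE => /orP[/eqP -> lti|ud lti]; last by rewrite IH ?orbT.
apply/orP; right; apply: (forest_code_stack_sub Hs).
by rewrite mem_cat; apply/orP; left; apply/mem_children; exists i; rewrite // -ca.
Qed.

Lemma obeys_sub c st d : obeys c st d ->
  {in st, forall u, family_tree c u} -> {in nodes st d, forall u, family_tree c u}.
Proof.
rewrite /obeys; elim: d st => [|a d IH] [|v st] //= [ca Hd] stT u.
rewrite inE => /orP[/eqP ->|]; first by apply: stT; rewrite mem_head.
apply: IH => // w; rewrite mem_cat => /orP[/mem_children[i lti ->]|wst].
  by apply: family_child; [apply: stT; rewrite mem_head | rewrite ca].
by apply: stT; rewrite inE wst orbT.
Qed.

(** The visited vertices lie in the tree, contain the root and are closed under
    taking children, because everything that enters the stack gets visited. *)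
Lemma family_tree_nodes c d : forest_code 1 d -> obeys c [:: [::]] d ->
  family_tree c = [set` tree_nodes d].
Proof.
move=> H Hd; rewrite eqEsubset; split=> u /=.
  elim=> [|v i _ IH lti]; last first.
    exact: (obeys_children (st := [:: [::]]) H Hd IH lti).
  by apply: (forest_code_stack_sub (st := [:: [::]]) H); rewrite inE.
apply: (obeys_sub Hd) => v; rewrite inE => /eqP ->; exact: family_root.
Qed.

(** Stacks of pairwise incomparable words have disjoint sets of descendants, which
    is why no vertex is visited twice. *)
Definition apart (u v : word) : bool := ~~ prefix u v && ~~ prefix v u.

Lemma prefix_rconsE (u v : word) i :
  prefix v (rcons u i) = (v == rcons u i) || prefix v u.
Proof.
apply/idP/orP => [/prefixP[s]|[/eqP ->|/prefixP[s ->]]].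
- case/lastP: s => [|s j]; first by rewrite cats0 => ->; left.
  by rewrite -rcons_cat => /rcons_inj[-> _]; right; exact: prefix_prefix.
- exact: prefix_refl.
- by rewrite rcons_cat prefix_prefix.
Qed.

Lemma prefix_eq (u v : word) : prefix u v -> size v <= size u -> u = v.
Proof.
by rewrite prefixE => /eqP E H; rewrite -{}E take_oversize.
Qed.

Lemma pairwise_apart_children u a : pairwise apart (children u a).
Proof.
apply/(pairwiseP [::]) => i j; rewrite !inE size_children => lti ltj ltij.
rewrite /children !(nth_map 0) ?size_iota // !nth_iota // !add0n.
have E k l : k != l -> ~~ prefix (rcons u k) (rcons u l).
  move=> neq; apply/negP => /prefix_eq; rewrite !size_rcons leqnn => /(_ isT).
  by move/rcons_inj => [ekl]; rewrite ekl eqxx in neq.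
by rewrite /apart !E //; lia.
Qed.

Lemma nodes_prefix st d v : v \in nodes st d -> exists2 u, u \in st & prefix u v.
Proof.
elim: d st => [|a d IH] [|u st] //=; rewrite inE => /orP[/eqP ->|].
  by exists u; rewrite ?mem_head ?prefix_refl.
case/IH => w; rewrite mem_cat => /orP[/mem_children[i _ ->]|wst] Hp.
  by exists u; rewrite ?mem_head // (prefix_trans (prefix_rcons u i)).
by exists w => //; rewrite inE wst orbT.
Qed.

Lemma uniq_nodes st d : pairwise apart st -> uniq (nodes st d).
Proof.
elim: d st => [|a d IH] [|u st] //=.
move=> /andP[/allP ust pst].
rewrite IH ?andbT.
  apply/negP => /nodes_prefix[w]; rewrite mem_cat => /orP[/mem_children[i _ ->]|].
    by move=> /size_prefix; rewrite size_rcons ltnn.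
  by move=> /ust /andP[_ /negP].
rewrite pairwise_cat pairwise_apart_children pst !andbT.
apply/allrelP => v w /mem_children[i _ ->] /ust /andP[nuw nwu].
rewrite /apart prefix_rconsE (negPf nwu) orbF.
have nw : ~~ prefix (rcons u i) w.
  by apply: contra nuw; apply: prefix_trans; exact: prefix_rcons.
by rewrite nw; apply: contra nw => /eqP ->; exact: prefix_refl.
Qed.

Lemma uniq_tree_nodes d : uniq (tree_nodes d).
Proof. exact: uniq_nodes. Qed.

(** The next vertex to be visited depends only on the degrees read so far, so two
    codes that agree with [c] can be compared entry by entry. *)
Lemma obeys_inj c st d e : forest_code (size st) d -> forest_code (size st) e ->
  obeys c st d -> obeys c st e -> d = e.
Proof.
rewrite /obeys; elim: d st e => [|a d IH] [|u st] [|b e] //= Hd He [ca Ed] [cb Ee].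
have eab : a = b by rewrite -ca -cb.
rewrite -{b}eab in He cb Ee *; congr (_ :: _).
by apply: (IH (children u a ++ st)); rewrite // size_cat size_children addnC.
Qed.

Lemma code_inj c d e : forest_code 1 d -> forest_code 1 e ->
  obeys c [:: [::]] d -> obeys c [:: [::]] e -> d = e.
Proof. exact: (@obeys_inj c [:: [::]]). Qed.

Lemma seq_card_eq (s : seq word) : uniq s -> ([set` s] #= `I_(size s))%card.
Proof.
move=> us; apply/card_esym.
have -> : [set` s] = (nth [::] s) @` `I_(size s).
  rewrite eqEsubset; split=> v /=.
    by move=> vs; exists (index v s); rewrite /= ?index_mem ?nth_index.
  by move=> [i lti <-]; exact: mem_nth.
apply/card_esym/inj_card_eq => i j; rewrite !inE /= => lti ltj /eqP.
by rewrite nth_uniq // => /eqP.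
Qed.

Lemma card_tree_size c d n : forest_code 1 d -> obeys c [:: [::]] d ->
  (family_tree c #= `I_n)%card -> size d = n.
Proof.
move=> H Hd; rewrite (family_tree_nodes H Hd) => Hn; rewrite -(size_tree_nodes H).
apply/card_eq_II; rewrite -(card_eqr Hn).
exact/card_esym/seq_card_eq/uniq_tree_nodes.
Qed.

(** Follow [c] for [m + 1] steps: the stack runs empty before or it does not. *)
Lemma obeys_total c m st :
  (exists d, [/\ size d <= m, forest_code (size st) d & obeys c st d]) \/
  (exists d, size (nodes st d) = m.+1 /\ obeys c st d).
Proof.
rewrite /obeys; elim: m st => [|m IH] [|u st].
- by left; exists [::].
- by right; exists [:: c u]; split; rewrite //=; case: (children _ _ ++ _).
- by left; exists [::].
have [[d [sd ld Hd]]|[d [sd Hd]]] := IH (children u (c u) ++ st).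
  left; exists (c u :: d); split => //=.
    by move: ld; rewrite size_cat size_children addnC.
  by rewrite /obeys /= Hd.
by right; exists (c u :: d); rewrite /obeys /= Hd sd.
Qed.

(** A tree with [n] vertices cannot be explored for [n + 1] steps, as no vertex is
    visited twice; so its exploration stops, and then it has seen the whole tree. *)
Lemma obeys_ex c n : (family_tree c #= `I_n)%card ->
  exists d, [/\ size d = n, forest_code 1 d & obeys c [:: [::]] d].
Proof.
move=> Hn; have [[d [_ ld Hd]]|[d [sd Hd]]] := obeys_total c n [:: [::]].
  by exists d; split => //; exact: card_tree_size Hd Hn.
suff : n.+1 <= n by rewrite ltnn.
rewrite -sd -card_le_II -(card_le_eqr Hn).
rewrite -(card_le_eql (seq_card_eq (uniq_tree_nodes d))).
apply: subset_card_le => v /=; apply: (obeys_sub Hd) => w.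
by rewrite inE => /eqP ->; exact: family_root.
Qed.

(** Outside the tree, [index] is out of range and the default value [0] applies. *)
Definition code_degree (d : seq nat) (u : word) : nat :=
  nth 0 d (index u (tree_nodes d)).

Lemma obeys_code_degree d : forest_code 1 d -> obeys (code_degree d) [:: [::]] d.
Proof.
move=> H; have sz := size_tree_nodes H.
apply: (@eq_from_nth _ 0); rewrite ?size_map // sz => i lti.
by rewrite (nth_map [::]) ?sz // /code_degree index_uniq ?sz ?uniq_tree_nodes.
Qed.

(** * Exchanging a vertex with one of its children *)

Definition swap_below (x y : nat) (t : word) : word :=
  match t with
  | [::] => [:: y]
  | a :: s => if a == x then
                match s with
                | b :: s' => if b == y then y :: x :: s' else s
                | [::] => [::]
                end
              else y :: t
  end.

(** The relabelling of all words when the vertex [p] changes places with its child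
    [rcons p x]: the child moves up to [p], the old [p] becomes its child number
    [y], and the old child number [y] of the moved vertex becomes child number [x]
    of the old [p]; all other subtrees follow their parents. *)
Definition swap (p : word) (x y : nat) (z : word) : word :=
  if prefix p z then p ++ swap_below x y (drop (size p) z) else z.

Lemma swap_cat p x y t : swap p x y (p ++ t) = p ++ swap_below x y t.
Proof. by rewrite /swap prefix_prefix drop_size_cat. Qed.

Lemma swap_off p x y z : ~~ prefix p z -> swap p x y z = z.
Proof. by rewrite /swap => /negPf ->. Qed.

Lemma swap_belowK x y : cancel (swap_below x y) (swap_below y x).
Proof.
move=> [|a s] /=; first by rewrite eqxx.
have [->|nax] := eqVneq a x; last by rewrite /= eqxx (negPf nax).
case: s => [|b s] //=; have [->|nby] := eqVneq b y; first by rewrite /= !eqxx.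
by rewrite /= (negPf nby).
Qed.

Lemma swapK p x y : cancel (swap p x y) (swap p y x).
Proof.
move=> z; have [/prefixP[t ->]|np] := boolP (prefix p z).
  by rewrite !swap_cat swap_belowK.
by rewrite !swap_off.
Qed.

(** The degree function of the relabelled tree: [swap p y x] is the inverse of
    [swap p x y]. *)
Definition swap_degrees (c : word -> nat) p x y : word -> nat :=
  fun z => c (swap p y x z).

Lemma swap_degreesK c p x y : swap_degrees (swap_degrees c p x y) p y x = c.
Proof. by apply/funext => z; rewrite /swap_degrees swapK. Qed.

(** Only descendants of [p] and [p] itself are relabelled, and the strict ancestors
    of [z] are too short for that. *)
Lemma family_tree_above c p x y z : family_tree c z -> size z <= size p ->
  family_tree (swap_degrees c p x y) z.
Proof.
elim=> [|u i _ IH lti]; first by move=> _; exact: family_root.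
rewrite size_rcons => szu; apply: family_child; first by apply: IH; exact: ltnW.
rewrite /swap_degrees swap_off //.
by apply/negP => /size_prefix; rewrite leqNgt szu.
Qed.

(** Induction along the tree. The relabelling commutes with taking children except
    at the edges into [p], from [p] to its child [x] and from there to its child
    [y]; the images of these vertices are [p], [rcons p y] and [rcons (rcons p y) x],
    which are found in the new tree beforehand. *)
Lemma family_tree_swap c p x y z : family_tree c (p ++ [:: x; y]) ->
  family_tree c z -> family_tree (swap_degrees c p x y) (swap p x y z).
Proof.
move=> Tpxy; set c' := swap_degrees c p x y.
have := Tpxy; rewrite -[[:: x; y]]/(rcons [:: x] y) -rcons_cat.
move=> /family_tree_rconsP[]; rewrite cats1 => Tpx lty.
have [Tp ltx] := family_tree_rconsP Tpx.
have Ec' v : c' (swap p x y v) = c v by rewrite /c' /swap_degrees swapK.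
have T'p : family_tree c' p by exact: family_tree_above.
have T'py : family_tree c' (rcons p y).
  apply: family_child => //; rewrite -(Ec' (rcons p x)) -cats1 swap_cat /= eqxx cats0 in lty.
  exact: lty.
have T'pyx : family_tree c' (rcons (rcons p y) x).
  apply: family_child => //; move: ltx; rewrite -(Ec' p) -{2}[p]cats0 swap_cat /=.
  by rewrite cats1.
elim=> [|u i Tu IH lti].
  have [/prefixP[t Et]|np] := boolP (prefix p [::]).
    by move: T'py; rewrite Et; case: (p) Et => //; case: t => //= _; rewrite /swap /=.
  by rewrite swap_off //; exact: family_root.
have [/prefixP[t Et]|npu] := boolP (prefix p u).
  move: IH lti; rewrite -(Ec' u) Et rcons_cat !swap_cat.
  case: t Et => [|a [|b t]] Et /=.
  - have [->|nix] := eqVneq i x; first by rewrite cats0.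
    by rewrite cats1 => ? ?; rewrite -cat_rcons cats1; exact: family_child.
  - have [Ea|nax] := eqVneq a x.
      rewrite cats0; have [-> _ _|niy] := eqVneq i y; last first.
        by rewrite cats1; exact: family_child.
      by rewrite -cat_rcons cats1.
    rewrite -[[:: y; a; i]]/(rcons [:: y; a] i) -rcons_cat.
    exact: family_child.
  - case: (a == x); last by rewrite -!rcons_cons -rcons_cat; exact: family_child.
    case: (b == y); rewrite -!rcons_cons -rcons_cat; exact: family_child.
have [/eqP Ep|np] := boolP (p == rcons u i).
  by rewrite -Ep -{2}[p]cats0 swap_cat cats1.
have np2 : ~~ prefix p (rcons u i) by rewrite prefix_rconsE (negPf np).
move: IH lti; rewrite -(Ec' u) !swap_off //; exact: family_child.
Qed.

Lemma swap_grandchild p x y s : swap p x y (p ++ [:: x, y & s]) = p ++ [:: y, x & s].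
Proof. by rewrite swap_cat /= !eqxx. Qed.

Lemma family_tree_swapE c p x y : family_tree c (p ++ [:: x; y]) ->
  family_tree (swap_degrees c p x y) = swap p x y @` family_tree c.
Proof.
move=> Tpxy; rewrite eqEsubset; split=> z; last first.
  by move=> [v Tv <-]; exact: family_tree_swap.
move=> Tz; exists (swap p y x z); last by rewrite swapK.
rewrite -(swap_degreesK c p x y); apply: family_tree_swap => //.
by rewrite -swap_grandchild; exact: family_tree_swap.
Qed.

(** * Pairs of vertices by their distances to the last common ancestor *)

(** The depth of the last common ancestor. *)
Fixpoint lcp (v w : word) : nat :=
  match v, w with
  | a :: v', b :: w' => if a == b then (lcp v' w').+1 else 0
  | _, _ => 0
  end.

Lemma lcpC v w : lcp v w = lcp w v.
Proof. by elim: v w => [|a v IH] [|b w] //=; rewrite eq_sym IH. Qed.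

Lemma lcp_size v w : lcp v w <= size v.
Proof. by elim: v w => [|a v IH] [|b w] //=; case: ifP => //=; rewrite ltnS. Qed.

Lemma lcpP v w : exists p s t, [/\ v = p ++ s, w = p ++ t, size p = lcp v w &
   match s, t with a :: _, b :: _ => a != b | _, _ => true end].
Proof.
elim: v w => [|a v IH] [|b w].
- by exists [::], [::], [::].
- by exists [::], [::], (b :: w).
- by exists [::], (a :: v), [::].
rewrite /=; have [<-|nab] := eqVneq a b; last by exists [::], (a :: v), (b :: w).
have [p [s [t [-> -> sp H]]]] := IH w.
by exists (a :: p), s, t; rewrite /= sp.
Qed.

Lemma lcp_branch p a b s t : a != b -> lcp (p ++ a :: s) (p ++ b :: t) = size p.
Proof. by move=> /negPf H; elim: p => [|i p IH] /=; rewrite ?H // eqxx IH. Qed.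

Lemma lcp_refl v : lcp v v = size v.
Proof. by elim: v => //= a v ->; rewrite eqxx. Qed.

Lemma lcp_rcons v i w : lcp v w <= lcp (rcons v i) w <= (lcp v w).+1.
Proof.
elim: v w => [|a v IH] [|b w] //=.
  by case: ifP => //; case: w.
by case: ifP => // _; rewrite !ltnS.
Qed.

Lemma tree_edgeP u v : tree_edge u v ->
  (exists i, v = rcons u i) \/ (exists i, u = rcons v i).
Proof.
have H : forall a b : word, is_child a b -> exists i, a = rcons b i.
  move=> a b /andP[/prefixP[s ->]]; case: s => [|i [|j s]] sz.
  - by move: sz; rewrite cats0 => /eqP; lia.
  - by exists i; rewrite cats1.
  - by move: sz; rewrite size_cat /= => /eqP; lia.
by case/orP => /H; [right|left].
Qed.

Lemma is_child_rcons u i : is_child (rcons u i) u.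
Proof. by rewrite /is_child prefix_rcons size_rcons eqxx. Qed.

(** A step changes [size v + size w - 2 * lcp v w] by at most one, and this vanishes
    for [v = w]. *)
Lemma walk_length (A : set word) (v w : word) l : walk tree_edge A v w l ->
  size v + size w <= 2 * lcp v w + l.
Proof.
move=> [s [_ + + <-]]; elim: s v => [|v' s IH] v /=.
  by move=> _ ->; rewrite lcp_refl; lia.
move=> /andP[/tree_edgeP ev ps] /(IH _ ps) {IH}.
have down (a b m m' n : nat) : m <= m' <= m.+1 -> a.+1 + b <= 2 * m' + n ->
  a + b <= 2 * m + n.+1 by lia.
have up (a b m m' n : nat) : m <= m' <= m.+1 -> a + b <= 2 * m + n ->
  a.+1 + b <= 2 * m' + n.+1 by lia.
case: ev => -[i ->]; rewrite size_rcons.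
  exact/down/lcp_rcons.
exact/up/lcp_rcons.
Qed.

Lemma walk_cons (A : set word) u v w l : A u -> tree_edge u v ->
  walk tree_edge A v w l -> walk tree_edge A u w l.+1.
Proof.
move=> Au euv [s [sA ps ls <-]]; exists (v :: s); split => //=; last by rewrite euv.
by move=> x; rewrite inE => /orP[/eqP ->//|]; exact: sA.
Qed.

Lemma walk_rcons (A : set word) u v w l : A w -> tree_edge v w ->
  walk tree_edge A u v l -> walk tree_edge A u w l.+1.
Proof.
move=> Aw evw [s [sA ps ls <-]]; exists (rcons s w); split => //=.
- move=> x; rewrite -rcons_cons mem_rcons inE => /orP[/eqP ->//|]; exact: sA.
- by rewrite rcons_path ps ls.
- by rewrite last_rcons.
- by rewrite size_rcons.
Qed.

Lemma walk_up_down c p s t : family_tree c (p ++ s) -> family_tree c (p ++ t) ->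
  walk tree_edge (family_tree c) (p ++ s) (p ++ t) (size s + size t).
Proof.
move=> Ts Tt; have Tp := family_tree_prefix Tt.
have : walk tree_edge (family_tree c) p (p ++ t) (size t).
  elim/last_ind: t Tt => [|t i IH].
    rewrite cats0 => _; exists [::]; split => // x.
    by rewrite inE => /eqP ->.
  rewrite -rcons_cat => Ti; have [/IH] := family_tree_rconsP Ti.
  rewrite size_rcons => + _; apply: walk_rcons => //.
  by rewrite /tree_edge is_child_rcons orbT.
elim/last_ind: s Ts => [|s i IH]; first by rewrite cats0.
rewrite -rcons_cat => Ti; have [/IH H _] := family_tree_rconsP Ti.
move/H; rewrite size_rcons; apply: walk_cons => //.
by rewrite /tree_edge is_child_rcons.
Qed.

(** The path through the last common ancestor attains the lower bound
    [walk_length]. *)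
Lemma at_distance_lcp c v w k : family_tree c v -> family_tree c w ->
  at_distance tree_edge (family_tree c) v w k ->
  size v + size w = 2 * lcp v w + k.
Proof.
move=> Tv Tw [/walk_length H1 H2].
have [p [s [t [Ev Ew sp _]]]] := lcpP v w.
have := walk_up_down (c := c) (p := p) (s := s) (t := t).
rewrite -Ev -Ew => /(_ Tv Tw)/H2.
move: H1; rewrite {1 3}Ev {1 3}Ew !size_cat sp; lia.
Qed.

(** * Weighted counts over the codes of a given size *)

Fixpoint compositions (n m : nat) : seq (seq nat) :=
  match n with
  | 0 => if m == 0 then [:: [::]] else [::]
  | n'.+1 => [seq a :: d | a <- iota 0 m.+1, d <- compositions n' (m - a)]
  end.

Lemma mem_compositions n m d : (d \in compositions n m) = (size d == n) && (sumn d == m).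
Proof.
elim: n m d => [|n IH] m d.
  case: d => [|a d] /=; last by case: ifP.
  by case: m.
apply/allpairsPdep/idP => [[a [e [+ + ->]]]|].
  by rewrite mem_iota IH /= => ? /andP[/eqP -> /eqP]; lia.
case: d => [//|a d] /andP[/eqP[sd] /eqP sm]; rewrite [sumn _]/= in sm.
exists a, d; split => //.
  by rewrite mem_iota; lia.
by rewrite IH sd eqxx /=; lia.
Qed.

Lemma uniq_compositions n m : uniq (compositions n m).
Proof.
elim: n m => [|n IH] m; first by rewrite /=; case: ifP.
apply: allpairs_uniq_dep => [||[a d] [b e] _ _ /= [-> ->]] //.
exact: iota_uniq.
Qed.

Definition tree_codes (n : nat) : seq (seq nat) :=
  [seq d <- compositions n n.-1 | forest_code 1 d].

Lemma mem_tree_codes n d : (d \in tree_codes n) = (size d == n) && forest_code 1 d.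
Proof.
rewrite mem_filter mem_compositions andbC; case H: (forest_code 1 d); rewrite ?andbF ?andbT //.
have sz : size d = 1 + sumn d := forest_code_sumn H.
by case: eqP => //= <-; rewrite sz eqxx.
Qed.

Lemma uniq_tree_codes n : uniq (tree_codes n).
Proof. by rewrite filter_uniq ?uniq_compositions. Qed.

Definition branch (i j : nat) (v w : word) : bool :=
  (size v == lcp v w + i) && (size w == lcp v w + j).

Definition pairs (i j : nat) (d : seq nat) : seq (word * word) :=
  [seq q <- [seq (v, w) | v <- tree_nodes d, w <- tree_nodes d]
         | branch i j q.1 q.2].

Lemma mem_pairs i j d v w : ((v, w) \in pairs i j d) =
  [&& v \in tree_nodes d, w \in tree_nodes d & branch i j v w].
Proof.
rewrite mem_filter /= andbC andbA; congr (_ && _).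
apply/allpairsP/andP => [[[a b] /= [? ? [-> ->]]]//|[vd wd]].
by exists (v, w).
Qed.

Lemma uniq_pairs i j d : uniq (pairs i j d).
Proof.
apply/filter_uniq/allpairs_uniq; [exact: uniq_tree_nodes | exact: uniq_tree_nodes|].
by move=> [a b] [a' b'].
Qed.

Lemma size_pairsC i j d : size (pairs i j d) = size (pairs j i d).
Proof.
have H a b : size (pairs a b d) <= size (pairs b a d).
  rewrite -(size_map (fun q => (q.2, q.1))); apply: uniq_leq_size.
    by rewrite map_inj_uniq ?uniq_pairs // => -[? ?] [? ?] [-> ->].
  move=> [v w] /mapP[[w' v']]; rewrite !mem_pairs => + [-> ->] /=.
  by rewrite /branch lcpC => /and3P[-> -> /=]; rewrite andbC.
by apply/eqP; rewrite eqn_leq !H.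
Qed.

(** Codes together with a marked pair of vertices, so that weighted counts of pairs
    become plain sums. *)
Definition flagged (n i j : nat) : seq (seq nat * (word * word)) :=
  [seq (d, q) | d <- tree_codes n, q <- pairs i j d].

Lemma mem_flagged n i j d v w : ((d, (v, w)) \in flagged n i j) =
  [&& d \in tree_codes n, v \in tree_nodes d, w \in tree_nodes d & branch i j v w].
Proof.
rewrite -mem_pairs; apply/allpairsPdep/andP => [[a [b [? ? [-> ->]]]]//|[? ?]].
by exists d, (v, w).
Qed.

Lemma uniq_flagged n i j : uniq (flagged n i j).
Proof.
apply: allpairs_uniq_dep; first exact: uniq_tree_codes.
  by move=> d _; exact: uniq_pairs.
by move=> [a b] [a' b'] _ _ /= [-> ->].
Qed.

Lemma branchP i j v w : branch i.+1 j.+1 v w -> exists p x s y t,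
  [/\ v = p ++ x :: s, w = p ++ y :: t, x != y, size s = i & size t = j].
Proof.
have [p [s [t [Ev Ew sp H]]]] := lcpP v w.
rewrite /branch -{}sp Ev Ew !size_cat !eqn_add2l => /andP[/eqP ss /eqP st].
case: s t H ss st Ev Ew => [|x s] [|y t] //= nxy [ss] [st] Ev Ew.
by exists p, x, s, y, t.
Qed.

(** The last common ancestor [p] of the marked vertices and its child towards the
    first of them have changed places. The degree function [c] is kept as a
    witness since the relation only fixes it on the tree. *)
Definition exchanged (a b : seq nat * (word * word)) : Prop :=
  exists p x y s x' t c,
    [/\ x != x', a.2 = (p ++ [:: x, y & s], p ++ x' :: t),
        b.2 = (p ++ [:: y, x & s], p ++ [:: y, x' & t]),
        obeys c [:: [::]] a.1 & obeys (swap_degrees c p x y) [:: [::]] b.1].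

(** In the image, the last common ancestor of the marked vertices is [rcons p y],
    which gives [p] and [y]; its child towards the first one gives [x]. Then
    [swap p x y] can be inverted. *)
Lemma exchanged_inj n i j a1 a2 b : a1 \in flagged n i j -> a2 \in flagged n i j ->
  b.1 \in tree_codes n -> exchanged a1 b -> exchanged a2 b -> a1 = a2.
Proof.
case: a1 a2 b => [d1 [v1 w1]] [d2 [v2 w2]] [e [v w]].
rewrite !mem_flagged /= !mem_tree_codes => /and4P[/andP[_ l1] _ _ _].
move=> /and4P[/andP[_ l2] vd2 _ _] /andP[_ le].
move=> [p [x [y [s [x' [t [c [nx [-> ->] [Ev Ew] o1 oe1]]]]]]]] /=.
move=> [q [z [u [s2 [z' [t2 [c2 [nz [ev2 ->] [Ev2 Ew2] o2 oe2]]]]]]]] /=.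
rewrite /= in o1 oe1 o2 oe2.
have E3 (r : word) k m (o : word) : r ++ [:: k, m & o] = rcons r k ++ m :: o.
  by rewrite cat_rcons.
move: (Ev) (Ew); rewrite Ev2 Ew2 !E3 => E1 E2.
have := lcp_branch (rcons p y) s t nx; rewrite -E1 -E2 lcp_branch // !size_rcons => -[spq].
move/eqP: E1; rewrite eqseq_cat ?size_rcons ?spq // => /andP[/eqP/rcons_inj[eq_p eq_y]].
move/eqP: E2; rewrite eqseq_cat ?size_rcons ?spq // => /andP[_ /eqP[eq_x' eq_t]].
move=> /eqP[eq_x eq_s]; subst q u z s2 z' t2 v2 => {Ev2 Ew2 E3 nz spq}.
rewrite cat_rcons; congr (_, _).
apply: (code_inj l1 l2 o1); rewrite /obeys -{2}o2.
apply/eq_in_map => r rd2; have T2 : family_tree (swap_degrees c2 p x y) = [set` tree_nodes e].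
  exact: family_tree_nodes.
have Tr : family_tree c2 r by rewrite (family_tree_nodes l2 o2).
have Tpxy : family_tree c2 (p ++ [:: x; y]).
  apply: (@family_tree_prefix _ _ s); rewrite -catA (family_tree_nodes l2 o2).
  exact: vd2.
have := family_tree_swap Tpxy Tr; rewrite T2 /= => re.
have : map (swap_degrees c p x y) (tree_nodes e) = map (swap_degrees c2 p x y) (tree_nodes e).
  by rewrite oe1 oe2.
by move=> /eq_in_map /(_ _ re); rewrite /swap_degrees swapK.
Qed.

Lemma obeys_family c d u : forest_code 1 d -> obeys c [:: [::]] d ->
  u \in tree_nodes d <-> family_tree c u.
Proof. by move=> ld od; rewrite (family_tree_nodes ld od). Qed.

(** The first marked vertex keeps its depth while the last common ancestor moves one
    level down; the second marked vertex moves down with it. *)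
Lemma exchange_ex n i j a : a \in flagged n i.+2 j.+1 -> exists b,
  [/\ b \in flagged n i.+1 j.+1, exchanged a b & perm_eq a.1 b.1].
Proof.
case: a => [d [v w]]; rewrite mem_flagged mem_tree_codes => /and4P[/andP[/eqP sd ld] vd wd].
move=> /branchP[p [x [s0 [x' [t [Ev Ew nx + st]]]]]].
case: s0 Ev => [//|y s] Ev [ss]; set c := code_degree d.
have od : obeys c [:: [::]] d by exact: obeys_code_degree.
have Tpxy : family_tree c (p ++ [:: x; y]).
  apply: (@family_tree_prefix _ _ s); rewrite -catA (family_tree_nodes ld od) /=.
  by rewrite -Ev.
pose c' := swap_degrees c p x y.
have sw_inj : injective (swap p x y) by exact: can_inj (swapK p x y).
have T' : family_tree c' = swap p x y @` family_tree c by exact: family_tree_swapE.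
have : (family_tree c' #= `I_n)%card.
  rewrite T' (card_eql (inj_card_eq _)); last by move=> ? ? _ _; exact: sw_inj.
  by rewrite (family_tree_nodes ld od) -sd -(size_tree_nodes ld) seq_card_eq ?uniq_tree_nodes.
move=> /obeys_ex[e [se le oe]].
have perm_nodes : perm_eq (map (swap p x y) (tree_nodes d)) (tree_nodes e).
  apply: uniq_perm; rewrite ?map_inj_uniq ?uniq_tree_nodes // => u.
  apply/mapP/idP => [[z zd ->]|ue].
    apply/(obeys_family _ le oe); apply: family_tree_swap => //.
    exact/(obeys_family _ ld od).
  have := (obeys_family u le oe).1 ue; rewrite T' => -[z Tz <-].
  by exists z => //; apply/(obeys_family _ ld od).
have Ev' : swap p x y v = p ++ [:: y, x & s] by rewrite Ev swap_grandchild.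
have Ew' : swap p x y w = p ++ [:: y, x' & t].
  by rewrite Ew swap_cat /= eq_sym (negPf nx).
exists (e, (p ++ [:: y, x & s], p ++ [:: y, x' & t])); split.
- rewrite mem_flagged mem_tree_codes se eqxx le -Ev' -Ew' /=.
  rewrite -!(perm_mem perm_nodes) !map_f //= Ev' Ew'.
  have E3 (r : word) k m (o : word) : r ++ [:: k, m & o] = rcons r k ++ m :: o.
    by rewrite cat_rcons.
  by rewrite /branch !E3 lcp_branch // !size_cat /= ss st !eqxx.
- by exists p, x, y, s, x', t, c; split; rewrite //= Ev Ew.
- rewrite /= -od -oe.
  suff -> : map c (tree_nodes d) = map c' (map (swap p x y) (tree_nodes d)).
    exact: perm_map.
  by rewrite -map_comp; apply: eq_map => z /=; rewrite /c' /swap_degrees swapK.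
Qed.

Lemma uniq_map_leq_sum {R : numDomainType} {A B : eqType} (s : seq A) (t : seq B)
    (F : A -> R) (G : B -> R) (f : A -> B) :
  uniq s -> {in s &, injective f} -> {in s, forall x, f x \in t} ->
  {in s, forall x, F x = G (f x)} -> (forall y, 0 <= G y)%R ->
  (\sum_(x <- s) F x <= \sum_(y <- t) G y)%R.
Proof.
move=> us finj fst FG G0.
have ufs : uniq (map f s) by rewrite map_inj_in_uniq.
have [t' pt] : exists t', perm_eq t (map f s ++ t').
  have : {subset map f s <= t} by move=> y /mapP[x xs ->]; exact: fst.
  clear fst FG; elim: (map f s) ufs t => [|y ys IH] /=; first by move=> _ t _; exists t.
  move=> /andP[nys uys] t sub; have yt : y \in t by apply: sub; rewrite mem_head.
  have [|t' pt] := IH uys (rem y t).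
    move=> z zys; have := sub z; rewrite inE zys orbT => /(_ isT).
    rewrite (perm_mem (perm_to_rem yt)) inE => /orP[/eqP Ez|//].
    by rewrite -Ez zys in nys.
  exists t'; rewrite (perm_trans (perm_to_rem yt)) //= perm_cons //.
rewrite (perm_big _ pt) big_cat big_map /= (eq_big_seq _ FG) lerDl.
exact: sumr_ge0.
Qed.

Section weights.
Context {R : realType} (p : nat -> R).
Hypothesis p0 : (forall i, 0 <= p i)%R.

Definition weight (d : seq nat) : R := (\prod_(a <- d) p a)%R.

Lemma weight_ge0 d : (0 <= weight d)%R.
Proof. by apply: prodr_ge0. Qed.

Lemma perm_weight d e : perm_eq d e -> weight d = weight e.
Proof. exact: perm_big. Qed.

Definition total (n i j : nat) : R :=
  (\sum_(d <- tree_codes n) weight d * (size (pairs i j d))%:R)%R.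

Lemma total_flagged n i j :
  (total n i j = \sum_(a <- flagged n i j) weight a.1)%R.
Proof.
rewrite big_allpairs_dep; apply: eq_bigr => d _ /=.
by rewrite big_const_seq count_predT iter_addr_0 mulr_natr.
Qed.

Lemma total_exchange n i j : (total n i.+2 j.+1 <= total n i.+1 j.+1)%R.
Proof.
rewrite !total_flagged.
have /choice[f Hf] : forall a, exists b, a \in flagged n i.+2 j.+1 ->
    [/\ b \in flagged n i.+1 j.+1, exchanged a b & perm_eq a.1 b.1].
  move=> a; have [/exchange_ex[b Hb]|na] := boolP (a \in flagged n i.+2 j.+1).
    by exists b.
  by exists a.
apply: (uniq_map_leq_sum (f := f)); first exact: uniq_flagged.
- move=> a1 a2 m1 m2 E; have [fl1 e1 _] := Hf _ m1; have [_ e2 _] := Hf _ m2.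
  rewrite -E in e2; apply: (exchanged_inj m1 m2 _ e1 e2).
  by case: (f a1) fl1 => d [v w]; rewrite mem_flagged => /and4P[].
- by move=> a /Hf[].
- by move=> a /Hf[_ _ /perm_weight].
- by move=> a; exact: weight_ge0.
Qed.

Lemma totalC n i j : total n i j = total n j i.
Proof. by apply: eq_bigr => d _; rewrite size_pairsC. Qed.

(** Reduce [i] by exchanges, then [j] after exchanging the roles of the two marked
    vertices. *)
Lemma total_le n i j : (total n i.+1 j.+1 <= total n 1 1)%R.
Proof.
elim: i => [|i IH]; last exact: le_trans (total_exchange _ _ _) IH.
by rewrite totalC; elim: j => [//|j IH]; exact: le_trans (total_exchange _ _ _) IH.
Qed.

End weights.

Definition sumsq (d : seq nat) : nat := \sum_(a <- d) a ^ 2.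

(** Such pairs are pairs of siblings: a vertex and two of its children. *)
Lemma size_pairs11 d : forest_code 1 d -> size (pairs 1 1 d) <= sumsq d.
Proof.
move=> ld; set c := code_degree d.
have od : obeys c [:: [::]] d by exact: obeys_code_degree.
pose L := [seq (rcons u q.1, rcons u q.2) | u <- tree_nodes d,
   q <- [seq (i, j) | i <- iota 0 (c u), j <- iota 0 (c u)]].
have -> : sumsq d = size L.
  rewrite size_allpairs_dep sumnE big_map /sumsq -{1}od big_map.
  by apply: eq_bigr => u _; rewrite size_allpairs size_iota.
apply: uniq_leq_size; first exact: uniq_pairs.
move=> [v w]; rewrite mem_pairs => /and3P[vd wd].
move=> /branchP[p [x [s [y [t [Ev Ew _ ]]]]]].
case: s Ev => // Ev _; case: t Ew => // Ew _.
move: vd wd; rewrite Ev Ew !cats1.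
move=> /(obeys_family _ ld od)/family_tree_rconsP[Tp ltx].
move=> /(obeys_family _ ld od)/family_tree_rconsP[_ lty].
apply/allpairsPdep; exists p, (x, y); split => //; first exact/(obeys_family _ ld od).
by apply/allpairsP; exists (x, y); rewrite !mem_iota.
Qed.

Lemma counting_seq_le (R : realType) (T : choiceType) (A : set T) (L : seq T) :
  A `<=` [set` L] -> (@counting T R A <= (size L)%:R%:E)%E.
Proof.
move=> AL; have fA : finite_set A by apply: sub_finite_set AL _; exact: finite_seq.
rewrite /counting asboolT // lee_fin ler_nat.
apply: uniq_leq_size; first exact: finmap.fset_uniq.
by move=> x; rewrite in_fset_set // inE => /AL.
Qed.

(** If one vertex is an ancestor of the other, the lower one determines the pair, the
    upper one being its ancestor [k] generations back; there are at most [size d]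
    such pairs. The others branch off from a common ancestor. *)
Lemma num_pairs_le (R : realType) k d : forest_code 1 d -> (0 < k) ->
  (num_pairs R k [set` tree_nodes d]
   <= (size d + \sum_(1 <= i < k) size (pairs i (k - i) d))%:R%:E)%E.
Proof.
move=> ld k0; set c := code_degree d.
have od : obeys c [:: [::]] d by exact: obeys_code_degree.
pose L1 := [seq [set take (size w - k) w; w] | w <- tree_nodes d].
pose L2 := flatten [seq [seq [set q.1; q.2] | q <- pairs i (k - i) d] | i <- index_iota 1 k].
have -> : size d + \sum_(1 <= i < k) size (pairs i (k - i) d) = size (L1 ++ L2).
  rewrite size_cat size_map size_tree_nodes //; congr (_ + _).
  rewrite size_flatten sumnE /shape -map_comp big_map.
  by apply: eq_bigr => i _; rewrite /= size_map.
apply: counting_seq_le => q [v [w []]] /=.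
rewrite -(family_tree_nodes ld od).
move=> /(obeys_family _ ld od) Tv /(obeys_family _ ld od) Tw.
move=> /(at_distance_lcp Tv Tw) Ed Eq.
rewrite mem_cat.
have anc v' w' : family_tree c w' -> size v' + size w' = 2 * lcp v' w' + k ->
    lcp v' w' = size v' -> [set v'; w'] \in L1.
  move=> Tw' E El; apply/mapP; exists w'; first exact/(obeys_family _ ld od).
  have [p [s [t [Ev Ew sp _]]]] := lcpP v' w'.
  have ss : s = [::].
    by move: El; rewrite -sp Ev size_cat => /esym/eqP; case: (s) => //= ? ?; lia.
  have Evp : v' = p by rewrite Ev ss cats0.
  suff -> : take (size w' - k) w' = v' by [].
  have -> : size w' - k = size p by rewrite -Evp; lia.
  by rewrite Ew take_size_cat.
have [El|nl] := eqVneq (lcp v w) (size v); first by rewrite Eq anc.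
have [El|nl'] := eqVneq (lcp v w) (size w).
  by rewrite Eq setUC anc // 1?lcpC // addnC Ed lcpC.
apply/orP; right; apply/flattenP.
have lev := lcp_size v w; have lew := lcp_size w v; rewrite lcpC in lew.
pose i := size v - lcp v w.
exists [seq [set q.1; q.2] | q <- pairs i (k - i) d].
  apply/mapP; exists i => //; rewrite mem_index_iota /i; lia.
rewrite Eq; apply/mapP; exists (v, w) => //; rewrite mem_pairs.
apply/and3P; split; [exact/(obeys_family _ ld od)|exact/(obeys_family _ ld od)|].
rewrite /branch /i; lia.
Qed.

Lemma num_pairs_ge0 (R : realType) k (tau : set word) : (0 <= num_pairs R k tau)%E.
Proof. by rewrite /num_pairs /counting; case: ifP => _; rewrite ?leey // lee_fin. Qed.

Section weights.
Context {R : realType} (p : nat -> R).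
Hypothesis p0 : (forall i, 0 <= p i)%R.

(** All [k - 1] pairs of distances to the last common ancestor are reduced to
    siblings by [total_le]. *)
Lemma weighted_pairs_le n k : 0 < k ->
  (\sum_(d <- tree_codes n) weight p d *
     (size d + \sum_(1 <= i < k) size (pairs i (k - i) d))%:R
   <= n%:R * (\sum_(d <- tree_codes n) weight p d) +
      k%:R * (\sum_(d <- tree_codes n) weight p d * (sumsq d)%:R))%R.
Proof.
move=> k0; rewrite [X in (_ <= X + _)%R]mulr_sumr.
under eq_bigr do rewrite natrD mulrDr natr_sum mulr_sumr.
rewrite big_split /= lerD //.
  rewrite le_eqVlt; apply/orP; left; apply/eqP; apply: eq_big_seq => d.
  by rewrite mem_tree_codes => /andP[/eqP -> _]; rewrite mulrC.
rewrite exchange_big /=.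
have bound i : 0 < i < k -> (\sum_(d <- tree_codes n) weight p d * (size (pairs i (k - i) d))%:R
    <= \sum_(d <- tree_codes n) weight p d * (sumsq d)%:R)%R.
  move=> /andP[i0 ik]; apply: (@le_trans _ _ (total p n 1 1)).
    by have := total_le p0 n i.-1 (k - i).-1; rewrite !prednK ?subn_gt0.
  rewrite /total !big_seq; apply: ler_sum => d; rewrite mem_tree_codes => /andP[_ ld].
  by rewrite ler_wpM2l ?weight_ge0 // ler_nat size_pairs11.
apply: (@le_trans _ _ (\sum_(1 <= i < k) \sum_(d <- tree_codes n) weight p d * (sumsq d)%:R))%R.
  by rewrite !big_nat; apply: ler_sum => i /bound.
rewrite sumr_const_nat -[leLHS]mulr_natl ler_wpM2r ?ler_nat ?leq_subr //.
by apply: sumr_ge0 => d _; rewrite mulr_ge0 ?weight_ge0.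
Qed.

End weights.

(** * The cycle lemma *)

Lemma forest_codeP m d : forest_code m d <->
  sumn d + m = size d /\ (forall k, k < size d -> k < m + sumn (take k d)).
Proof.
elim: d m => [|a d IH] m /=.
  by split=> [/eqP -> //|[/eqP + _]]; rewrite add0n.
split=> [/andP[m0 /IH[sd H]]|[sd H]].
  split; first lia.
  by case=> [|k]; rewrite ?addn0 // ltnS => /H /=; lia.
have m0 : 0 < m by have := H 0 isT; rewrite addn0.
rewrite m0; apply/IH; split=> [|k kd]; first lia.
by have /= := H k.+1 kd; lia.
Qed.

Lemma sumn_rot r (e : seq nat) : sumn (rot r e) = sumn e.
Proof. by rewrite -[in RHS](cat_take_drop r e) /rot !sumn_cat addnC. Qed.

(** If both held, the first [r] entries would have sum at least [r] and the others at
    least their number, which exceeds the total [size e - 1]. *)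
Lemma forest_code_rot_unique r e :
  0 < r < size e -> forest_code 1 e -> forest_code 1 (rot r e) -> False.
Proof.
move=> /andP[r0 re] /forest_codeP[se He] /forest_codeP[_]; rewrite size_rot => Hr.
have lt1 := He r re; have lt2 : size e - r < 1 + sumn (drop r e).
  have := Hr (size e - r); rewrite /rot take_size_cat ?size_drop //; apply.
  by rewrite ltn_subrL r0 (leq_ltn_trans _ re).
have := sumn_cat (take r e) (drop r e); rewrite cat_take_drop.
by move: se lt1 lt2; clear -re; lia.
Qed.

(** Start the rotation at the first maximum of [k - sumn (take k e)]: after it this
    quantity never exceeds its value there, before it it is strictly smaller, and
    one full turn adds one. *)
Lemma forest_code_rot_ex e : sumn e + 1 = size e ->
  exists2 r, r < size e & forest_code 1 (rot r e).
Proof.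
move=> se; set n := size e; pose S k := sumn (take k e).
have n0 : 0 < n by rewrite /n -se; lia.
have Sle k : S k <= sumn e.
  by have := sumn_cat (take k e) (drop k e); rewrite cat_take_drop /S; lia.
(* Maximising [g] selects the first maximum: differences of [k - S k] count at
   least [n], and ties are broken by [n - k]. *)
pose g (k : 'I_n) := n * (k + (n - S k)) + (n - k).
have [r _ rmax] := @arg_maxnP _ (Ordinal n0) xpredT g isT.
have rn : r < n := ltn_ord r.
exists r => //; apply/forest_codeP; rewrite sumn_rot size_rot; split=> // k kn.
have Sr : sumn (drop r e) = sumn e - S r.
  by have := sumn_cat (take r e) (drop r e); rewrite cat_take_drop /S; lia.
have best l : l < n -> (l < r -> l + S r < r + S l) /\ (l + S r <= r + S l).
  move=> ln; have := rmax (Ordinal ln) isT; rewrite /g /=.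
  have := Sle l; have := Sle r; rewrite -/n in se; move: (S l) (S r) => a b.
  have [lt|lt|eq] := ltngtP (l + (n - a)) (r + (n - b)).
  - by move: lt; clear -se; lia.
  - move: (leq_mul (leqnn n) lt); rewrite mulnS.
    move: (n * _) (n * _) => u v; clear -ln; lia.
  - by rewrite eq; move: (n * _) eq => u; clear -se ln rn; lia.
have [krn|] := ltnP k (n - r).
  have -> : take k (rot r e) = take k (drop r e).
    by rewrite /rot take_cat size_drop krn.
  have : S (r + k) = S r + sumn (take k (drop r e)).
    by rewrite /S takeD sumn_cat.
  have [_] := best (r + k) ltac:(lia); lia.
move=> nrk; have -> : sumn (take k (rot r e)) = sumn (drop r e) + S (k - (n - r)).
  rewrite /rot take_cat size_drop -/n ltnNge nrk /= sumn_cat /S take_takel //; lia.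
have [] := best (k - (n - r)) ltac:(lia).
have := Sle r; rewrite Sr; lia.
Qed.

Lemma count_forest_code_rot e n : size e = n -> sumn e + 1 = n ->
  \sum_(r <- iota 0 n) forest_code 1 (rot r e) = 1.
Proof.
move=> sz se; have [r rn lr] := forest_code_rot_ex (etrans se (esym sz)); rewrite sz in rn.
rewrite (bigD1_seq r) ?mem_iota ?iota_uniq //= lr big_seq_cond big1 // => s.
rewrite mem_iota add0n => /andP[/= sn nsr]; case ls: forest_code => //; exfalso.
(* Two good rotations differ by a rotation of a code that is again a code. *)
have key a b : a < b -> b < n -> forest_code 1 (rot a e) -> forest_code 1 (rot b e) -> False.
  move=> ab bn la lb; apply: (@forest_code_rot_unique (b - a) (rot a e)) => //.
    by rewrite size_rot sz; lia.
  by rewrite -rotD; [rewrite subnK // ltnW | rewrite sz; lia].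
have [srlt|srgt|srE] := ltngtP s r; last by rewrite srE eqxx in nsr.
  exact: key srlt rn ls lr.
exact: key srgt sn lr ls.
Qed.

Lemma perm_rot_compositions n m r :
  perm_eq (map (rot r) (compositions n m)) (compositions n m).
Proof.
have inv e : (rot r e \in compositions n m) = (e \in compositions n m).
  by rewrite !mem_compositions size_rot sumn_rot.
apply: uniq_perm; rewrite ?(map_inj_uniq (can_inj (rotK r))) ?uniq_compositions //.
move=> e; apply/mapP/idP => [[d dn ->]|en]; first by rewrite inv.
by exists (rotr r e); rewrite ?rotrK // -inv rotrK.
Qed.

Section cycle.
Context {R : realType}.

Lemma sum_rot_compositions n m (F : seq nat -> R) :
  (\sum_(e <- compositions n m) \sum_(r <- iota 0 n) F (rot r e) =
   n%:R * \sum_(e <- compositions n m) F e)%R.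
Proof.
rewrite exchange_big /= (eq_bigr (fun=> \sum_(e <- compositions n m) F e)%R).
  by rewrite big_const_seq count_predT size_iota iter_addr_0 mulr_natl.
by move=> r _; rewrite -[RHS](perm_big _ (perm_rot_compositions n m r)) /= big_map.
Qed.

(** Exactly one of the [n] rotations of a sequence of length [n] and sum [n - 1]
    encodes a tree. *)
Lemma cycle_lemma n (F : seq nat -> R) : 0 < n -> (forall r e, F (rot r e) = F e) ->
  (\sum_(e <- compositions n n.-1) F e = n%:R * \sum_(d <- tree_codes n) F d)%R.
Proof.
move=> n0 Frot; rewrite big_filter.
rewrite [in RHS]big_mkcond -sum_rot_compositions; apply: eq_big_seq => e.
rewrite mem_compositions => /andP[/eqP sz /eqP se].
under eq_bigr do rewrite Frot -mulrb.
rewrite sumrMnr count_forest_code_rot ?mulr1n //; lia.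
Qed.

(** The heads of the [n] rotations of [e] are the entries of [e]. *)
Lemma head_sumsq n m (p : nat -> R) :
  (\sum_(e <- compositions n m) weight p e * (sumsq e)%:R =
   n%:R * \sum_(e <- compositions n m) weight p e * (head 0 e ^ 2)%:R)%R.
Proof.
rewrite -sum_rot_compositions; apply: eq_big_seq => e.
rewrite mem_compositions => /andP[/eqP sz _].
rewrite (eq_big_seq (fun r => weight p e * (nth 0 e r ^ 2)%:R))%R.
  rewrite -mulr_sumr -natr_sum; congr (_ * _%:R)%R.
  by rewrite /sumsq (big_nth 0) sz /index_iota subn0.
move=> r; rewrite mem_iota add0n => /= rn.
have pr : perm_eq (rot r e) e by rewrite perm_rot.
by rewrite (perm_weight p pr) -nth0 /rot nth_cat size_drop subn_gt0 sz rn nth_drop addn0.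
Qed.

(** Point probabilities of sums of independent variables are coefficients of powers
    of the generating function; summands above [m] cannot occur in a sum equal to
    [m], so a polynomial suffices. *)
Lemma coef_compositions (p : nat -> R) n m t : m < t ->
  (\sum_(e <- compositions n m) weight p e = ((\poly_(i < t) p i) ^+ n)`_m)%R.
Proof.
elim: n m => [|n IH] m mt.
  rewrite expr0 coef1 /=; case: eqP => _; rewrite ?big_nil //.
  by rewrite big_seq1 /weight big_nil.
rewrite exprS coefM big_allpairs_dep -[iota 0 m.+1]/(index_iota 0 m.+1) big_mkord.
apply: eq_bigr => i _; rewrite coef_poly (leq_ltn_trans _ mt) ?leq_ord //.
rewrite -IH; last by apply: leq_ltn_trans mt; exact: leq_subr.
by rewrite mulr_sumr; apply: eq_bigr => e _; rewrite /weight big_cons.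
Qed.

Lemma coef_compositions_head (p : nat -> R) n m :
  (\sum_(e <- compositions n.+1 m) weight p e * (head 0 e ^ 2)%:R =
   \sum_(i < m.+1) p i * (i ^ 2)%:R * \sum_(e <- compositions n (m - i)) weight p e)%R.
Proof.
rewrite big_allpairs_dep -[iota 0 m.+1]/(index_iota 0 m.+1) big_mkord.
apply: eq_bigr => i _; rewrite mulr_sumr; apply: eq_bigr => e _.
by rewrite /weight big_cons /= -!mulrA; congr (_ * _)%R; rewrite mulrC.
Qed.

End cycle.

(** * Local bounds for fair coin tossing *)

Lemma bin_odd_central m : 'C(m.+1.*2, m.+1) = 2 * 'C(m.*2.+1, m).
Proof.
rewrite doubleS binS mul2n -[RHS]addnn; congr (_ + _).
have le : m <= m.*2.+1 by lia.
by rewrite -(bin_sub le); congr 'C(_, _); lia.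
Qed.

Lemma bin_central_rec m : m.+1 * 'C(m.+1.*2, m.+1) = 2 * (m.*2.+1 * 'C(m.*2, m)).
Proof.
have le : m <= m.*2.+1 by lia.
rewrite bin_odd_central -(bin_sub le); have -> : m.*2.+1 - m = m.+1 by lia.
by rewrite mulnCA -mul_bin_diag.
Qed.

(** By [bin_central_rec], squared quotients of neighbouring central coefficients are
    [4 (2 m + 1) ^ 2 / (m + 1) ^ 2], and [4 (2 m + 1) (2 m + 3) <= 16 (m + 1) ^ 2]. *)
Lemma bin_central_upper m : 'C(m.*2, m) ^ 2 * m.*2.+1 <= 4 ^ m.*2.
Proof.
elim: m => [//|m IH]; have := bin_central_rec m.
move: 'C(m.+1.*2, m.+1) => y; move: 'C(m.*2, m) IH => x IH rec.
rewrite -(leq_pmul2l (m := m.+1 ^ 2)) // mulnA -expnMn rec.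
rewrite doubleS 2!(expnS 4); move: (4 ^ _) IH => q IH.
have -> : (2 * (m.*2.+1 * x)) ^ 2 * m.*2.+3 =
  (4 * m.*2.+1 * m.*2.+3) * (x ^ 2 * m.*2.+1) by ring.
apply: leq_trans (leq_mul (leqnn _) IH) _.
have -> : m.+1 ^ 2 * (4 * (4 * q)) = (16 * m.+1 ^ 2) * q by ring.
by rewrite leq_mul2r; apply/orP; right; nia.
Qed.

(** The same quotients, with [16 m (m + 1) <= 4 (2 m + 1) ^ 2]. *)
Lemma bin_central_lower m : 4 ^ m.+1.*2 <= 4 * m.+1 * 'C(m.+1.*2, m.+1) ^ 2.
Proof.
elim: m => [//|m IH]; have := bin_central_rec m.+1.
move: 'C(m.+2.*2, m.+2) => y; move: 'C(m.+1.*2, m.+1) IH => x IH rec.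
rewrite -(leq_pmul2l (m := m.+2)) //.
have -> : m.+2 * (4 * m.+2 * y ^ 2) = 4 * (m.+2 * y) ^ 2 by ring.
rewrite rec (doubleS m.+1) 2!(expnS 4); move: (4 ^ _) IH => q IH.
have -> : 4 * (2 * (m.+1.*2.+1 * x)) ^ 2 = 16 * m.+1.*2.+1 ^ 2 * x ^ 2 by ring.
rewrite -(leq_pmul2l (m := m.+1)) //.
have -> : m.+1 * (16 * m.+1.*2.+1 ^ 2 * x ^ 2) =
  4 * m.+1.*2.+1 ^ 2 * (4 * m.+1 * x ^ 2) by ring.
apply: leq_trans _ (leq_mul (leqnn _) IH).
have -> : m.+1 * (m.+2 * (4 * (4 * q))) = (m.+1 * m.+2 * 16) * q by ring.
by rewrite leq_mul2r; apply/orP; right; nia.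
Qed.

Lemma bin_incr n m : m.+1.*2 <= n.+1 -> 'C(n, m) <= 'C(n, m.+1).
Proof.
move=> le; rewrite -(leq_pmul2l (m := m.+1)) // mul_bin_left leq_mul2r.
by apply/orP; right; lia.
Qed.

Lemma bin_half_sym n l : exists2 l', l'.*2 <= n & 'C(n, l) = 'C(n, l') \/ n < l.
Proof.
have [le|gt] := leqP l.*2 n; first by exists l => //; left.
have [le|gt'] := leqP l n; last by exists 0 => //; right.
exists (n - l); first lia.
by left; rewrite bin_sub.
Qed.

Lemma bin_le_half n l : 'C(n, l) <= 'C(n, n./2).
Proof.
have [l' le [->|gt]] := bin_half_sym n l; last by rewrite bin_small.
have : l' <= n./2 by lia.
have : n./2.*2 <= n by lia.
elim: n./2 => [|h IH] hn; first by rewrite leqn0 => /eqP ->.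
rewrite leq_eqVlt => /orP[/eqP -> //|]; rewrite ltnS => /IH H.
by apply: (leq_trans (H _)); [lia | apply: bin_incr; lia].
Qed.

Lemma bin_half_upper n : 'C(n, n./2) ^ 2 * n <= 4 ^ n.
Proof.
rewrite -[n in _ * n]odd_double_half -[n in 4 ^ n]odd_double_half.
rewrite -[n in 'C(n, _)]odd_double_half.
set m := n./2; case: (odd n) => /=; last first.
  rewrite !add0n; apply: leq_trans _ (bin_central_upper m).
  by rewrite leq_mul2l leqnSn orbT.
rewrite !add1n; have := bin_central_upper m.+1; rewrite bin_odd_central expnMn doubleS.
by rewrite (expnS 4 m.*2.+1); move: (4 ^ _) ('C(_, _) ^ 2) => q x; nia.
Qed.

Lemma bin_half_lower n : 0 < n -> 4 ^ n <= 4 * n * 'C(n, n./2) ^ 2.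
Proof.
move=> n0; have E := odd_double_half n.
move: n0; rewrite -[n in 4 ^ n]E -[n in 4 * n]E -[n in 'C(n, _)]E -[n in 0 < n]E.
set m := n./2; case: (odd n) => /=.
  move=> _; rewrite !add1n; have := bin_central_lower m.
  rewrite bin_odd_central expnMn doubleS.
  by rewrite (expnS 4 m.*2.+1); move: (4 ^ _) ('C(_, _) ^ 2) => q x; nia.
rewrite !add0n; case: m => [//|m] _; apply: leq_trans (bin_central_lower m) _.
by rewrite leq_mul2r; apply/orP; right; lia.
Qed.

Section real_bounds.
Context {R : realType}.
Local Open Scope ring_scope.

(** The probability of [l] heads in [n] tosses of a fair coin. *)
Definition coin (n l : nat) : R := 'C(n, l)%:R / 2 ^+ n.

Lemma coin_ge0 n l : 0 <= coin n l.
Proof. by rewrite divr_ge0 ?exprn_ge0. Qed.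

Lemma coin_upper n l : (0 < n)%N -> coin n l <= (Num.sqrt n%:R)^-1.
Proof.
move=> n0; have s0 : 0 < Num.sqrt (n%:R : R) by rewrite sqrtr_gt0 ltr0n.
rewrite /coin ler_pdivrMr ?exprn_gt0 // [leRHS]mulrC ler_pdivlMr //.
rewrite -(@ler_pXn2r _ 2) ?nnegrE ?exprn_ge0 ?mulr_ge0 ?sqrtr_ge0 //.
rewrite exprMn sqr_sqrtr ?ler0n // -exprM mulnC exprM -!natrX -natrM ler_nat.
apply: leq_trans _ (bin_half_upper n).
by rewrite leq_mul2r leq_exp2r // bin_le_half orbT.
Qed.

Lemma coin_ratio n l : (l.+1.*2 <= n)%N ->
  coin n l.+1 * (1 - 2 * (n - l.*2)%:R / n%:R) <= coin n l.
Proof.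
move=> ln; have n0 : 0 < n%:R :> R by rewrite ltr0n; lia.
have rec : (l.+1%:R * coin n l.+1 = (n - l)%:R * coin n l).
  by rewrite /coin !mulrA -!natrM mul_bin_left.
have nl : 0 < (n - l)%:R :> R by rewrite ltr0n; lia.
rewrite -(ler_pM2l nl) -rec mulrCA [leRHS]mulrC ler_wpM2l ?coin_ge0 //.
rewrite -mulrA; set y := (n - l.*2)%:R / n%:R.
have y0 : 0 <= y by rewrite divr_ge0.
have Ey : y * n%:R = n%:R - 2 * l%:R.
  by rewrite /y mulfVK ?gt_eqF // natrB -?mul2n ?natrM //; lia.
have ln2 : 2 * l%:R <= n%:R :> R by rewrite -natrM ler_nat; lia.
have := ler_wpM2l y0 ln2; rewrite natrB; last by lia.
rewrite -natr1; nra.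
Qed.

Lemma expR_le_1B (x : R) : 0 <= x <= 1 / 2 -> expR (- (2 * x)) <= 1 - x.
Proof.
move=> /andP[x0 x1]; rewrite expRN invf_ple ?posrE ?expR_gt0 //; last by lra.
apply: (@le_trans _ _ (1 + 2 * x)); last exact: expR_ge1Dx.
rewrite -[leLHS]mul1r ler_pdivrMr; [nra | lra].
Qed.

(** From the middle down to [l] there are [s] steps, and by [coin_ratio] none of
    their factors is smaller than the last one. *)
Lemma coin_half_ratio n l s : (l + s)%N = n./2 -> (n - l.*2)%:R / n%:R <= 1 / 4 :> R ->
  coin n n./2 * expR (- (4 * (n - l.*2)%:R / n%:R) * s%:R) <= coin n l.
Proof.
elim: s l => [|s IH] l E small.
  by rewrite mulr0 expR0 mulr1 -E addn0.
have n0 : 0 < n%:R :> R by rewrite ltr0n; lia.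
have mono : (n - l.+1.*2)%:R / n%:R <= (n - l.*2)%:R / n%:R :> R.
  by rewrite ler_pM2r ?invr_gt0 // ler_nat; lia.
have := IH l.+1; rewrite addSnnS => /(_ E (le_trans mono small)) H.
apply: le_trans (coin_ratio _); last by lia.
set x := (n - l.*2)%:R / n%:R in mono small *.
have x0 : 0 <= x by rewrite divr_ge0.
rewrite -[s.+1%:R]natr1 mulrDr mulr1 expRD mulrA.
have -> : - (4 * (n - l.*2)%:R / n%:R) = - (4 * x) by rewrite /x mulrA.
have -> : 2 * (n - l.*2)%:R / n%:R = 2 * x by rewrite /x mulrA.
apply: ler_pM; rewrite ?mulr_ge0 ?coin_ge0 ?expR_ge0 //.
  apply: le_trans H; rewrite ler_wpM2l ?coin_ge0 // ler_expR ler_wpM2r //.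
  by rewrite lerN2 -mulrA ler_wpM2l.
have -> : 4 * x = 2 * (2 * x) by ring.
by apply: expR_le_1B; lra.
Qed.

Lemma coin_half_lower n : (0 < n)%N -> (2 * Num.sqrt n%:R)^-1 <= coin n n./2.
Proof.
move=> n0; have s0 : 0 < Num.sqrt (n%:R : R) by rewrite sqrtr_gt0 ltr0n.
rewrite /coin ler_pdivlMr ?exprn_gt0 // mulrC ler_pdivrMr ?mulr_gt0 //.
rewrite -(@ler_pXn2r _ 2) ?nnegrE ?exprn_ge0 ?mulr_ge0 ?sqrtr_ge0 //.
rewrite !exprMn sqr_sqrtr ?ler0n // -exprM mulnC exprM -!natrX -!natrM ler_nat.
by rewrite mulnC; exact: bin_half_lower.
Qed.

(** With [x = (n - 2 l) / n], at most [x n / 2] steps of [coin_half_ratio], each with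
    a factor at least [exp (- 4 x)], lead from the middle to [l]; and
    [2 x ^ 2 n <= 2 K]. *)
Lemma coin_lower (K : R) n l : 0 <= K -> (0 < n)%N -> 16 * K <= n%:R ->
  (l.*2%:R - n%:R) ^+ 2 <= K * n%:R -> expR (- (2 * K)) / (2 * Num.sqrt n%:R) <= coin n l.
Proof.
move=> K0 n0 nK; wlog le : l / (l.*2 <= n)%N.
  move=> H hK; have [le|gt] := leqP l.*2 n; first exact: H.
  have nR : 0 < n%:R :> R by rewrite ltr0n.
  have [ln|nl] := leqP l n.
    have -> : coin n l = coin n (n - l) by rewrite /coin bin_sub.
    apply: H; first lia.
    rewrite -sqrrN opprB (_ : n%:R - _ = l.*2%:R - n%:R) //.
    rewrite -!mul2n !natrM natrB //; ring.
  have : n%:R <= l.*2%:R - n%:R :> R by rewrite lerBrDr -natrD ler_nat; lia.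
  nra.
move=> hK.
have nR : 0 < n%:R :> R by rewrite ltr0n.
set x := (n - l.*2)%:R / n%:R : R.
have x0 : 0 <= x by rewrite divr_ge0.
have Ex : x * n%:R = (n - l.*2)%:R by rewrite /x mulfVK ?gt_eqF.
have x2 : x ^+ 2 * n%:R <= K.
  rewrite -(ler_pM2r nR) -mulrA -expr2 -exprMn Ex natrB // -sqrrN opprB.
  exact: hK.
have small : x <= 1 / 4.
  rewrite leNgt; apply/negP => x4; have : (1 / 4) ^+ 2 < x ^+ 2.
    by rewrite ltr_pXn2r ?nnegrE //; lra.
  nra.
have [s Es] : exists s, (l + s)%N = n./2 by exists (n./2 - l)%N; lia.
apply: le_trans (coin_half_ratio Es small).
rewrite mulrC; apply: ler_pM; rewrite ?expR_ge0 ?invr_ge0 ?mulr_ge0 ?sqrtr_ge0 ?coin_half_lower //.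
rewrite ler_expR -[4 * _ / _]mulrA -/x mulNr lerN2.
have s2 : 2 * s%:R <= x * n%:R by rewrite Ex -natrM ler_nat; lia.
have : 0 <= s%:R :> R by [].
nra.
Qed.

End real_bounds.

Local Open Scope ring_scope.

(** * Polynomials as finite measures on the natural numbers *)

Section expectation.
Context {R : realType}.
Implicit Types (F G : {poly R}) (f g : nat -> R).

(** A polynomial with nonnegative coefficients serves as a finite measure on the
    natural numbers, with mass [F`_i] at [i]; products are convolutions, so the
    powers of a generating polynomial are the laws of sums of independent
    variables. *)
Definition integ F g : R := \sum_(i < size F) F`_i * g i.

Definition nonneg F : Prop := forall i, 0 <= F`_i.

Lemma integ_widen n F g : (size F <= n)%N -> integ F g = \sum_(i < n) F`_i * g i.
Proof.
move=> le; rewrite /integ (big_ord_widen_cond n xpredT (fun i => F`_i * g i)) //.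
rewrite big_mkcond; apply: eq_bigr => i _ /=.
by case: ltnP => // /leq_sizeP/(_ _ (leqnn _)) ->; rewrite mul0r.
Qed.

Lemma eq_integ F f g : f =1 g -> integ F f = integ F g.
Proof. by move=> fg; apply: eq_bigr => i _; rewrite fg. Qed.

Lemma integDl F G g : integ (F + G) g = integ F g + integ G g.
Proof.
pose n := maxn (size F) (size G).
rewrite (@integ_widen n (F + G)) ?size_polyD //.
rewrite (@integ_widen n F) ?leq_maxl // (@integ_widen n G) ?leq_maxr // -big_split.
by apply: eq_bigr => i _; rewrite coefD mulrDl.
Qed.

Lemma integ0 g : integ 0 g = 0.
Proof. by rewrite /integ size_poly0 big_ord0. Qed.

Lemma integZ a F g : integ (a *: F) g = a * integ F g.
Proof.
rewrite (@integ_widen (size F)) ?size_scale_leq // /integ mulr_sumr.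
by apply: eq_bigr => i _; rewrite coefZ mulrA.
Qed.

Lemma integ_sum (I : Type) (r : seq I) (H : I -> {poly R}) g :
  integ (\sum_(i <- r) H i) g = \sum_(i <- r) integ (H i) g.
Proof. exact: (big_morph (integ ^~ g) (fun F G => integDl F G g) (integ0 g)). Qed.

Lemma integ_Xn a F g : integ ('X^a * F) g = integ F (fun j => g (a + j)%N).
Proof.
rewrite (@integ_widen (a + size F)); last first.
  by apply: leq_trans (size_polyMleq _ _) _; rewrite size_polyXn.
rewrite big_split_ord /= big1 ?add0r => [|i _].
  by apply: eq_bigr => i _; rewrite coefXnM ltnNge leq_addr addKn.
by rewrite coefXnM ltn_ord mul0r.
Qed.

Lemma integM F G g : integ (F * G) g = integ F (fun i => integ G (fun j => g (i + j)%N)).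
Proof.
rewrite -[in LHS](coefK F) poly_def mulr_suml integ_sum.
by apply: eq_bigr => i _; rewrite -scalerAl integZ integ_Xn.
Qed.

Lemma integ1 g : integ 1 g = g 0%N.
Proof. by rewrite /integ size_poly1 big_ord1 coef1 mul1r. Qed.

Lemma integ_Xn1 a g : integ 'X^a g = g a.
Proof. by rewrite -[X in integ X]mulr1 integ_Xn integ1 addn0. Qed.

Lemma integC a g : integ a%:P g = a * g 0%N.
Proof. by rewrite -[a%:P]mulr1 mul_polyC integZ integ1. Qed.

Lemma integDr F f g : integ F (fun i => f i + g i) = integ F f + integ F g.
Proof. by rewrite -big_split; apply: eq_bigr => i _; rewrite mulrDr. Qed.

Lemma integZr F a g : integ F (fun i => a * g i) = a * integ F g.
Proof. by rewrite mulr_sumr; apply: eq_bigr => i _; rewrite mulrCA. Qed.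

Lemma integ_le F f g : nonneg F -> (forall i, F`_i != 0 -> f i <= g i) ->
  integ F f <= integ F g.
Proof.
move=> F0 fg; apply: ler_sum => i _; have [->|/fg le] := eqVneq F`_i 0.
  by rewrite !mul0r.
exact: ler_wpM2l.
Qed.

Lemma integ_ge0 F g : nonneg F -> (forall i, 0 <= g i) -> 0 <= integ F g.
Proof. by move=> F0 g0; apply: sumr_ge0 => i _; exact: mulr_ge0. Qed.

Lemma integ_coef F m : integ F (fun i => (i == m)%:R) = F`_m.
Proof.
rewrite (@integ_widen (maxn (size F) m.+1)) ?leq_maxl //.
have ltm : (m < maxn (size F) m.+1)%N by rewrite leq_maxr.
rewrite (bigD1 (Ordinal ltm)) //= eqxx mulr1 big1 ?addr0 // => i ne.
case: eqP => [E|_]; last by rewrite mulr0.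
by case/eqP: ne; exact: val_inj.
Qed.

Definition mass F : R := integ F (fun=> 1).

Lemma massM F G : mass (F * G) = mass F * mass G.
Proof.
rewrite /mass integM mulrC -integZr; apply: eq_integ => i.
by rewrite mulr1.
Qed.

Lemma massX F n : mass (F ^+ n) = mass F ^+ n.
Proof.
elim: n => [|n IH]; first by rewrite !expr0 /mass integ1.
by rewrite !exprS massM IH.
Qed.

Lemma nonnegD F G : nonneg F -> nonneg G -> nonneg (F + G).
Proof. by move=> F0 G0 i; rewrite coefD addr_ge0. Qed.

Lemma nonnegM F G : nonneg F -> nonneg G -> nonneg (F * G).
Proof. by move=> F0 G0 i; rewrite coefM sumr_ge0 // => j _; rewrite mulr_ge0. Qed.

Lemma nonnegX F n : nonneg F -> nonneg (F ^+ n).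
Proof.
move=> F0; elim: n => [|n IH]; last by rewrite exprS; exact: nonnegM.
by move=> i; rewrite expr0 coef1.
Qed.

Lemma nonnegZ a F : 0 <= a -> nonneg F -> nonneg (a *: F).
Proof. by move=> a0 F0 i; rewrite coefZ mulr_ge0. Qed.

Lemma nonnegXn n : nonneg 'X^n.
Proof. by move=> i; rewrite coefXn. Qed.

Lemma mass_ge0 F : nonneg F -> 0 <= mass F.
Proof. by move=> F0; exact: integ_ge0. Qed.

Lemma mass_exp_le1 F n : nonneg F -> mass F <= 1 -> mass (F ^+ n) <= 1.
Proof. by move=> F0 F1; rewrite massX exprn_ile1 // mass_ge0. Qed.

(** The centring grows with the number [n] of summands, so that deviations of
    independent summands add up. *)
Definition dev (c : R) (n i : nat) : R := i%:R - n%:R * c.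

Lemma dev_pow1 F n c : nonneg F -> mass F <= 1 ->
  `|integ (F ^+ n) (dev c n)| <= n%:R * `|integ F (dev c 1)|.
Proof.
move=> F0 F1; elim: n => [|n IH].
  by rewrite expr0 integ1 /dev mul0r subrr normr0 mul0r.
rewrite exprSr integM.
under eq_integ => i.
  rewrite (@eq_integ _ _ (fun j => dev c n i * 1 + dev c 1 j)); last first.
    by move=> j; rewrite /dev natrD -natr1; ring.
  rewrite integDr integZr -/(mass F) mulrC; over.
rewrite integDr integZr -[X in integ _ (fun=> X)]mulr1 integZr -/(mass (F ^+ n)).
rewrite -natr1 mulrDl mul1r (le_trans (ler_normD _ _)) // lerD //.
  by rewrite normrM (ger0_norm (mass_ge0 F0)) (le_trans _ IH) // ler_piMl.
by rewrite normrM (ger0_norm (mass_ge0 (nonnegX n F0))) ler_piMr ?mass_exp_le1.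
Qed.

(** The variances of the summands add up to the first term; the second one is the
    square of the bound [dev_pow1] for the mean, since [c] need not be the exact mean of [F]. *)
Lemma dev_pow2 F n c : nonneg F -> mass F <= 1 ->
  integ (F ^+ n) (fun i => dev c n i ^+ 2) <=
  n%:R * integ F (fun i => dev c 1 i ^+ 2) + (n%:R * integ F (dev c 1)) ^+ 2.
Proof.
move=> F0 F1; elim: n => [|n IH].
  by rewrite expr0 integ1 /dev !mul0r subrr expr0n /= addr0.
set e2 := integ F _ in IH *; set e1 := integ F _ in IH *.
have -> : integ (F ^+ n.+1) (fun i => dev c n.+1 i ^+ 2) =
    (mass F * integ (F ^+ n) (fun i => dev c n i ^+ 2) +
     (2 * e1) * integ (F ^+ n) (dev c n)) + e2 * mass (F ^+ n).
  rewrite -!integZr -!integDr exprSr integM; apply: eq_integ => i.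
  rewrite (@eq_integ _ _ (fun j => (dev c n i ^+ 2 * 1 + (2 * dev c n i) * dev c 1 j)
     + dev c 1 j ^+ 2)); last by move=> j; rewrite /dev natrD -natr1; ring.
  by rewrite !integDr !integZr -/(mass F) -/e1 -/e2; ring.
have H1 := dev_pow1 n c F0 F1; rewrite -/e1 in H1.
set E1 := integ _ (dev c n) in H1 *; set E2 := integ _ _ in IH *.
have E20 : 0 <= E2 by apply: integ_ge0 => [|i]; [exact: nonnegX | exact: sqr_ge0].
have e20 : 0 <= e2 by apply: integ_ge0 => // i; exact: sqr_ge0.
have cross : e1 * E1 <= n%:R * e1 ^+ 2.
  rewrite (le_trans (ler_norm _)) // normrM -real_normK ?num_real // expr2.
  by rewrite mulrA (mulrC n%:R) -mulrA ler_wpM2l.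
have M1 : mass F * E2 <= E2 by rewrite ler_piMl.
have M2 : e2 * mass (F ^+ n) <= e2 by rewrite ler_piMr ?mass_exp_le1.
have sq : 0 <= e1 ^+ 2 by exact: sqr_ge0.
rewrite -(natr1 n) exprMn in IH *; nra.
Qed.

End expectation.

(** * A local limit estimate for sums with a fair coin component *)

Section block.
Context {R : realType} (theta : R) (y h : nat).
Hypothesis theta_gt0 : 0 < theta.
Hypothesis h_gt0 : (0 < h)%N.

(** The generating polynomial of [h] times a fair coin. *)
Definition toss : {poly R} := 2^-1 *: (1 + 'X^h).

Lemma integ_toss i g :
  integ (toss ^+ i) g = \sum_(l < i.+1) coin i l * g (h * l)%N.
Proof.
rewrite /toss exprZn exprDn scaler_sumr integ_sum; apply: eq_bigr => l _.
rewrite expr1n mul1r -exprM -[X in _ *: X]scaler_nat scalerA integZ integ_Xn1.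
by rewrite /coin exprVn; congr (_ * _); rewrite mulrC.
Qed.

Lemma nonneg_toss : nonneg toss.
Proof.
apply: nonnegZ; first by rewrite invr_ge0.
by apply: nonnegD; [exact: (nonnegXn 0) | exact: nonnegXn].
Qed.

Lemma mass_toss : mass toss = 1.
Proof.
rewrite /mass /toss integZ integDl integ1 integ_Xn1 -[1 + 1]/(2%:R).
by rewrite mulVf // pnatr_eq0.
Qed.

(** The probability that [w] plus [h] times the number of heads in [i] tosses is
    [m]. *)
Definition toss_at (i w m : nat) : R := integ (toss ^+ i) (fun l => (w + l == m)%N%:R).

Lemma toss_at_ge0 i w m : 0 <= toss_at i w m.
Proof. by apply: integ_ge0 => [|l]; rewrite ?ler0n //; exact/nonnegX/nonneg_toss. Qed.

Lemma toss_at_le1 i w m : toss_at i w m <= 1.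
Proof.
apply: (@le_trans _ _ (mass (toss ^+ i))); last by rewrite massX mass_toss expr1n.
by apply: integ_le => [|l _]; [exact/nonnegX/nonneg_toss | rewrite lern1 leq_b1].
Qed.

Lemma toss_at_upper i w m : (0 < i)%N -> toss_at i w m <= (Num.sqrt i%:R)^-1.
Proof.
move=> i0; rewrite /toss_at integ_toss.
have [[l El]|no] := pselect (exists l : 'I_i.+1, (w + h * l)%N == m).
  rewrite (bigD1 l) //= El mulr1 big1 ?addr0 ?coin_upper // => k nkl.
  case: eqP => [E|_]; last by rewrite mulr0.
  case/eqP: nkl; apply/val_inj/eqP; rewrite /= -(eqn_pmul2l h_gt0) -(eqn_add2l w).
  by rewrite E (eqP El).
rewrite big1 ?invr_ge0 ?sqrtr_ge0 // => l _.
by case: eqP => [El|_]; rewrite ?mulr0 //; case: no; exists l; exact/eqP.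
Qed.

Lemma toss_at_lower i w l : coin i l <= toss_at i w (w + h * l)%N.
Proof.
have [li|il] := ltnP l i.+1; last first.
  by rewrite /coin bin_small // mul0r toss_at_ge0.
rewrite /toss_at integ_toss.
rewrite (bigD1 (Ordinal li)) //= eqxx mulr1 lerDl sumr_ge0 // => k _.
by rewrite mulr_ge0 ?coin_ge0.
Qed.

Variable Q : {poly R}.
Hypothesis Q0 : nonneg Q.

(** The expectation of [phi i v] where, among [N] steps with law
    [Q + theta *: 'X^y], [i] is the number of steps of the second kind and [v] the
    sum of the others. *)
Definition mix (N : nat) (phi : nat -> nat -> R) : R :=
  \sum_(i < N.+1) 'C(N, i)%:R * theta ^+ i * integ (Q ^+ (N - i)) (phi i).

Lemma mix_expand S N g :
  integ ((Q + theta *: ('X^y * S)) ^+ N) g =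
  mix N (fun i v => integ (S ^+ i) (fun l => g (v + y * i + l)%N)).
Proof.
rewrite exprDn integ_sum; apply: eq_bigr => i _.
rewrite exprZn exprMn -exprM -[X in integ X]scaler_nat -scalerAr scalerA integZ integM.
congr (_ * _); apply: eq_integ => v; rewrite integ_Xn; apply: eq_integ => l.
by rewrite addnA.
Qed.

Lemma mix_count N g :
  mix N (fun i _ => g i) = integ (((mass Q)%:P + theta *: 'X) ^+ N) g.
Proof.
rewrite exprDn integ_sum; apply: eq_bigr => i _.
rewrite exprZn -[X in _ = integ X _]scaler_nat -scalerAr scalerA integZ.
rewrite [X in integ X g]mulrC integ_Xn -polyC_exp integC addn0 -massX; congr (_ * _).
by rewrite mulrC /mass -integZr; apply: eq_integ => v; rewrite mulr1.
Qed.

Lemma mix_le N phi psi :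
  (forall i v, (i <= N)%N -> (Q ^+ (N - i))`_v != 0 -> phi i v <= psi i v) ->
  mix N phi <= mix N psi.
Proof.
move=> le; apply: ler_sum => i _; rewrite ler_wpM2l //.
  by rewrite mulr_ge0 // exprn_ge0 ?ltW.
by apply: integ_le => [|v vQ]; [exact: nonnegX | apply: le; rewrite // leq_ord].
Qed.

Lemma mixD N phi psi : mix N (fun i v => phi i v + psi i v) = mix N phi + mix N psi.
Proof. by rewrite -big_split; apply: eq_bigr => i _; rewrite integDr mulrDr. Qed.

Lemma mixZ N a phi : mix N (fun i v => a * phi i v) = a * mix N phi.
Proof. by rewrite mulr_sumr; apply: eq_bigr => i _; rewrite integZr mulrCA. Qed.

(** [block] is the law of one step, [drift] forgets the coin, and [counter] only
    counts whether there is a coin. All three have the same mixing weights, so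
    that moments of the last two can be inserted into the expansion of powers of
    the first. *)
Definition block : {poly R} := Q + theta *: ('X^y * toss).
Definition drift : {poly R} := Q + theta *: 'X^y.
Definition counter : {poly R} := (mass Q)%:P + theta *: 'X.

Lemma coef_block N m : (block ^+ N)`_m = mix N (fun i v => toss_at i (v + y * i)%N m).
Proof. by rewrite -integ_coef mix_expand. Qed.

Lemma mix_drift N g : mix N (fun i v => g (v + y * i)%N) = integ (drift ^+ N) g.
Proof.
rewrite /drift -['X^y]mulr1 mix_expand; apply: eq_bigr => i _; congr (_ * _).
by apply: eq_integ => v; rewrite expr1n integ1 addn0.
Qed.

Lemma mass_drift : mass drift = mass Q + theta.
Proof. by rewrite /mass integDl integZ integ_Xn1 mulr1. Qed.

Lemma mass_counter : mass counter = mass Q + theta.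
Proof. by rewrite {1}/mass integDl integC integZ -[X in integ X]expr1 integ_Xn1 !mulr1. Qed.

Lemma nonneg_drift : nonneg drift.
Proof. by apply: nonnegD => //; apply: nonnegZ (nonnegXn _); exact: ltW. Qed.

Lemma nonneg_counter : nonneg counter.
Proof.
apply: nonnegD => [i|]; first by rewrite coefC; case: ifP => // _; exact: mass_ge0.
by apply: nonnegZ; [exact: ltW | exact: (nonnegXn 1)].
Qed.

Hypothesis mass_le1 : mass Q + theta <= 1.

Lemma mix_mass N : mix N (fun _ _ => 1) = (mass Q + theta) ^+ N.
Proof. by rewrite (mix_count N (fun=> 1)) -/(mass _) massX mass_counter. Qed.

Lemma theta_le1 : theta <= 1.
Proof. by apply: le_trans mass_le1; rewrite lerDr mass_ge0. Qed.

(** This and [mix_dev_drift] are the second moment bounds behind Chebyshev's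
    inequality, for the number of coins and for the sum of everything else. *)
Lemma mix_dev_count N : N%:R * integ counter (dev theta 1) ^+ 2 <= 1 ->
  mix N (fun i _ => dev theta N i ^+ 2) <= 3 * N%:R.
Proof.
move=> e1; rewrite (mix_count N (fun i => dev theta N i ^+ 2)).
have F1 : mass counter <= 1 by rewrite mass_counter.
apply: le_trans (dev_pow2 N theta nonneg_counter F1) _.
have N0 : 0 <= N%:R :> R by [].
have e2 : integ counter (fun i => dev theta 1 i ^+ 2) <= 2.
  rewrite integDl integC integZ -['X]expr1 integ_Xn1 /dev.
  have := theta_le1; have := mass_ge0 Q0; have := theta_gt0; move: mass_le1.
  rewrite mul1r sub0r sqrrN; move: (mass Q) theta => M t; nra.
rewrite exprMn expr2 -mulrA; nra.
Qed.

Lemma mix_dev_drift N a V : N%:R * integ drift (dev a 1) ^+ 2 <= 1 ->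
  integ drift (fun i => dev a 1 i ^+ 2) <= V ->
  mix N (fun i v => dev a N (v + y * i)%N ^+ 2) <= (V + 1) * N%:R.
Proof.
move=> e1 e2; rewrite (mix_drift N (fun i => dev a N i ^+ 2)).
have F1 : mass drift <= 1 by rewrite mass_drift.
apply: le_trans (dev_pow2 N a nonneg_drift F1) _.
have N0 : 0 <= N%:R :> R by [].
rewrite exprMn expr2 -mulrA; nra.
Qed.

(** With at least [theta N / 2] coins every value has probability at most of order
    [1 / sqrt N]; having fewer coins has probability [O(1 / N)] by Chebyshev's
    inequality. *)
Lemma block_upper N m : (0 < N)%N -> N%:R * integ counter (dev theta 1) ^+ 2 <= 1 ->
  (block ^+ N)`_m <= (Num.sqrt (2 / theta) + 12 / theta ^+ 2) / Num.sqrt N%:R.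
Proof.
move=> N0 e1; rewrite coef_block.
have NR : 0 < N%:R :> R by rewrite ltr0n.
have sN : 0 < Num.sqrt (N%:R : R) by rewrite sqrtr_gt0.
pose u := Num.sqrt (2 / theta) / Num.sqrt N%:R.
pose b := 4 / (theta * N%:R) ^+ 2.
have u0 : 0 <= u by rewrite divr_ge0 ?sqrtr_ge0.
have b0 : 0 <= b by rewrite divr_ge0 ?sqr_ge0.
have tN : 0 < theta * N%:R by rewrite mulr_gt0.
apply: (@le_trans _ _ (mix N (fun i v => u * 1 + b * dev theta N i ^+ 2))).
  apply: mix_le => i v iN _; rewrite mulr1.
  have [big|small] := leP (theta * N%:R / 2) i%:R.
    have iR : 0 < i%:R :> R by apply: lt_le_trans big; rewrite divr_gt0.
    have i0 : (0 < i)%N by rewrite -(ltr0n R).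
    apply: le_trans (toss_at_upper _ _ i0) _; rewrite -[leLHS]addr0 lerD //; last first.
      by rewrite mulr_ge0 ?sqr_ge0.
    rewrite /u -sqrtrV ?ler0n // -[(Num.sqrt N%:R)^-1]sqrtrV ?ler0n // -sqrtrM; last first.
      by rewrite divr_ge0 ?ltW.
    apply: ler_wsqrtr.
    have -> : 2 / theta * N%:R^-1 = (theta * N%:R / 2)^-1.
      by field; rewrite !gt_eqF.
    by rewrite lef_pV2 ?posrE ?divr_gt0.
  apply: le_trans (toss_at_le1 _ _ _) _; rewrite -[leLHS]add0r lerD //.
  rewrite /b mulrAC ler_pdivlMr ?exprn_gt0 // mul1r /dev; nra.
rewrite mixD !mixZ mix_mass mulrDl lerD //.
  by rewrite -/u ler_piMr // exprn_ile1 ?addr_ge0 ?mass_ge0 // ltW.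
apply: le_trans (ler_wpM2l b0 (mix_dev_count e1)) _.
have -> : b * (3 * N%:R) = 12 / theta ^+ 2 * N%:R^-1.
  by rewrite /b; field; rewrite !gt_eqF.
rewrite ler_wpM2l ?divr_ge0 ?sqr_ge0 // lef_pV2 ?posrE //.
rewrite -[leRHS]sqr_sqrtr ?ler0n // expr2 ler_peMl ?sqrtr_ge0 //.
by rewrite -[leLHS](@sqrtr1 R) ler_wsqrtr // ler1n.
Qed.

Lemma nonneg_supp_exp n : (forall i, Q`_i != 0 -> (h %| i)%N) ->
  forall i, (Q ^+ n)`_i != 0 -> (h %| i)%N.
Proof.
move=> hQ; elim: n => [|n IH] i.
  by rewrite expr0 coef1; case: i => [|i]; rewrite ?dvdn0 //= eqxx.
rewrite exprS coefM; apply: contraR => nh; apply/eqP/big1 => j _.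
have [->|/hQ hj] := eqVneq Q`_j 0; first by rewrite mul0r.
have [->|/IH hij] := eqVneq (Q ^+ n)`_(i - j) 0; first by rewrite mulr0.
by case/negP: nh; rewrite -(subnKC (leq_ord j)) dvdn_add.
Qed.

Section lower.
Variables (N m : nat) (a r V : R).
Hypothesis r0 : 0 <= r.
Hypothesis hQ : forall i, Q`_i != 0 -> (h %| i)%N.
Hypothesis hy : (h %| y)%N.
Hypothesis hm : (h %| m)%N.
Hypothesis near : `|m%:R - N%:R * (a + theta * h%:R / 2)| <= r.
(* Chebyshev's bounds [3 / L] and [(V + 1) / L] then add up to one half. *)
Let L : R := 2 * (V + 4).
Let K : R := 24 * (r ^+ 2 + L + h%:R ^+ 2 * L) / theta.
Hypothesis L0 : 0 <= L.
Hypothesis N_large : 4 * L / theta ^+ 2 + 32 * (K + 1) / theta <= N%:R.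

(** For typical [i] and [v] the number of heads needed to reach [m] is an integer
    within [O(sqrt i)] of [i / 2], where [coin_lower] applies. Here [K] bounds the
    squared distance, through [(x - y - z) ^ 2 <= 3 (x ^ 2 + y ^ 2 + z ^ 2)] and
    [N <= 2 i / theta]. *)
Lemma toss_at_typical i v : (i <= N)%N -> (Q ^+ (N - i))`_v != 0 ->
  dev theta N i ^+ 2 <= L * N%:R -> dev a N (v + y * i)%N ^+ 2 <= L * N%:R ->
  expR (- (2 * K)) / 2 / Num.sqrt N%:R <= toss_at i (v + y * i)%N m.
Proof.
move=> iN vQ; set w := (v + y * i)%N; rewrite /dev => di dw.
have K0 : 0 <= K.
  apply: divr_ge0; last exact: ltW.
  have := mulr_ge0 (sqr_ge0 (h%:R : R)) L0; have := sqr_ge0 r; move: L0; lra.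
have t1 := theta_le1; have t0 := theta_gt0.
have part1 : 0 <= 4 * L / theta ^+ 2.
  by apply: divr_ge0; [exact: mulr_ge0 | exact: sqr_ge0].
have part2 : 32 <= 32 * (K + 1) / theta.
  rewrite ler_pdivlMr //; nra.
have part3 : 32 * (K + 1) / theta <= N%:R.
  by apply: le_trans N_large; rewrite lerDr.
have NR : 32 <= N%:R :> R := le_trans part2 part3.
have tN : 32 * (K + 1) <= theta * N%:R.
  by rewrite [leRHS]mulrC -ler_pdivrMr.
have tN2 : 4 * L + theta ^+ 2 <= theta ^+ 2 * N%:R.
  rewrite [leRHS]mulrC -ler_pdivrMr ?exprn_gt0 // mulrDl divff ?gt_eqF ?exprn_gt0 //.
  by apply: le_trans N_large; rewrite lerD2l; move: part2; lra.
have i_large : theta * N%:R / 2 <= i%:R.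
  rewrite leNgt; apply/negP => ilt.
  have : (theta * N%:R / 2) ^+ 2 < L * N%:R.
    apply: lt_le_trans di; rewrite -[ltRHS]sqrrN ltr_pXn2r ?nnegrE //; nra.
  have : 0 < N%:R :> R by lra.
  nra.
have iK : 16 * K + 16 <= i%:R by lra.
have i0 : (0 < i)%N by rewrite -(ltr0n R); lra.
set D : R := m%:R - w%:R.
have hR : 1 <= h%:R :> R by rewrite ler1n.
have spread : (D - h%:R * i%:R / 2) ^+ 2 <= K / 4 * i%:R.
  have near2 : (m%:R - N%:R * (a + theta * h%:R / 2)) ^+ 2 <= r ^+ 2.
    by rewrite -real_normK ?num_real // lerXn2r ?nnegrE.
  set x1 := m%:R - _ in near2.
  have -> : D - h%:R * i%:R / 2 =
      x1 - (w%:R - N%:R * a) - h%:R / 2 * (i%:R - N%:R * theta).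
    by rewrite /D /x1; field.
  move: dw di; set x2 := w%:R - _; set x3 := i%:R - N%:R * theta => dw di.
  have sq3 : (x1 - x2 - h%:R / 2 * x3) ^+ 2 <=
      3 * (x1 ^+ 2 + x2 ^+ 2 + h%:R ^+ 2 * x3 ^+ 2).
    have := sqr_ge0 (x1 + x2); have := sqr_ge0 (x1 + h%:R / 2 * x3).
    have := sqr_ge0 (x2 - h%:R / 2 * x3); have := sqr_ge0 (h%:R * x3).
    by rewrite !exprMn !expr2; nra.
  apply: le_trans sq3 _.
  have s3 : h%:R ^+ 2 * x3 ^+ 2 <= h%:R ^+ 2 * (L * N%:R) by rewrite ler_wpM2l ?sqr_ge0.
  have r2 : r ^+ 2 <= r ^+ 2 * N%:R by rewrite ler_peMr ?sqr_ge0 //; lra.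
  apply: (@le_trans _ _ (3 * ((r ^+ 2 + L + h%:R ^+ 2 * L) * N%:R))); first by lra.
  have -> : K / 4 * i%:R = 3 * ((r ^+ 2 + L + h%:R ^+ 2 * L) * (2 * i%:R / theta)).
    by rewrite /K; field; rewrite gt_eqF.
  rewrite ler_wpM2l // ler_wpM2l //; last by rewrite ler_pdivlMr //; lra.
  by have := mulr_ge0 (sqr_ge0 (h%:R : R)) L0; have := sqr_ge0 r; move: L0; lra.
have wm : (w <= m)%N.
  rewrite leqNgt; apply/negP => mw; have D0 : D < 0 by rewrite subr_lt0 ltr_nat.
  have : i%:R / 2 <= h%:R * i%:R / 2 - D by nra.
  move=> far; have : (i%:R / 2) ^+ 2 <= (h%:R * i%:R / 2 - D) ^+ 2.
    by rewrite lerXn2r ?nnegrE //; lra.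
  rewrite -(sqrrN (h%:R * _ / 2 - _)) opprB; nra.
have hw : (h %| w)%N by rewrite dvdn_add ?(nonneg_supp_exp hQ vQ) // dvdn_mulr.
have [l El] : exists l, m = (w + h * l)%N.
  by exists ((m - w) %/ h)%N; rewrite mulnC divnK ?dvdn_sub // subnKC.
have near_l : (l.*2%:R - i%:R) ^+ 2 <= K * i%:R.
  have ED : D = h%:R * l%:R by rewrite /D El natrD natrM addrAC subrr add0r.
  rewrite -muln2 natrM.
  have -> : (l%:R * 2 - i%:R) ^+ 2 = 4 * (l%:R - i%:R / 2) ^+ 2 :> R by field.
  have : (l%:R - i%:R / 2) ^+ 2 <= (D - h%:R * i%:R / 2) ^+ 2.
    have -> : D - h%:R * i%:R / 2 = h%:R * (l%:R - i%:R / 2) by rewrite ED; field.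
    by rewrite exprMn ler_peMl ?sqr_ge0 // expr_ge1.
  lra.
rewrite El; apply: le_trans (toss_at_lower _ _ _).
apply: le_trans (coin_lower K0 i0 _ near_l); last by lra.
have si : 0 < 2 * Num.sqrt (i%:R : R) by rewrite mulr_gt0 // sqrtr_gt0 ltr0n.
have sN : 0 < 2 * Num.sqrt (N%:R : R).
  by rewrite mulr_gt0 // sqrtr_gt0; move: NR; lra.
rewrite -mulrA ler_wpM2l ?expR_ge0 // -invfM lef_pV2 ?posrE //.
by rewrite ler_wpM2l // ler_wsqrtr // ler_nat.
Qed.

(** Pairs [(i, v)] outside the typical range have total weight at most one half, by
    the two second moment bounds; they are paid for by subtracting Chebyshev terms
    instead of being cut off. *)
Lemma block_lower : (0 < N)%N -> 0 <= V ->
  N%:R * integ counter (dev theta 1) ^+ 2 <= 1 ->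
  N%:R * integ drift (dev a 1) ^+ 2 <= 1 ->
  integ drift (fun i => dev a 1 i ^+ 2) <= V ->
  3 / 4 <= (mass Q + theta) ^+ N ->
  expR (- (2 * K)) / 8 / Num.sqrt N%:R <= (block ^+ N)`_m.
Proof.
move=> N0 V0 e1 e2 e3 massN; rewrite coef_block.
set c := expR (- (2 * K)) / 2 / Num.sqrt N%:R.
have NR : 0 < N%:R :> R by rewrite ltr0n.
have c0 : 0 <= c by rewrite !divr_ge0 ?sqrtr_ge0 ?expR_ge0.
have LN : 0 < L * N%:R by rewrite mulr_gt0 // /L; lra.
pose d1 i := dev theta N i ^+ 2; pose d2 i v := dev a N (v + y * i)%N ^+ 2.
have H : mix N (fun i v => c * 1) <=
    mix N (fun i v => toss_at i (v + y * i)%N m + c / (L * N%:R) * (d1 i + d2 i v)).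
  apply: mix_le => i v iN vQ; rewrite mulr1.
  have d1p : 0 <= d1 i by exact: sqr_ge0.
  have d2p : 0 <= d2 i v by exact: sqr_ge0.
  have T0 := toss_at_ge0 i (v + y * i)%N m.
  have [g1|b1] := leP (d1 i) (L * N%:R); last first.
    rewrite -[leLHS]add0r lerD // mulrAC ler_pdivlMr // ler_wpM2l //; lra.
  have [g2|b2] := leP (d2 i v) (L * N%:R); last first.
    rewrite -[leLHS]add0r lerD // mulrAC ler_pdivlMr // ler_wpM2l //; lra.
  rewrite -[leLHS]addr0 lerD ?toss_at_typical //.
  by apply: mulr_ge0; [apply: divr_ge0 => //; exact: ltW | exact: addr_ge0].
move: H; rewrite mixD !mixZ mix_mass mixD.
have H1 := mix_dev_count e1; have H2 := mix_dev_drift e2 e3.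
have : c / (L * N%:R) * (mix N (fun i _ => d1 i) + mix N d2) <= c / 2.
  rewrite -mulrA ler_wpM2l // mulrC ler_pdivrMr // /L; rewrite /d1 /d2; nra.
have -> : expR (- (2 * K)) / 8 / Num.sqrt N%:R = c / 4.
  by rewrite /c; field; rewrite gt_eqF // sqrtr_gt0.
nra.
Qed.
End lower.

End block.

(** * Local limit bounds for the offspring distribution *)

Section local_limit.
Context {R : realType} (p : nat -> R) (K : R).
Hypothesis p_ge0 : forall i, 0 <= p i.
Hypothesis mass_le1 : forall t, \sum_(i < t) p i <= 1.
Hypothesis mass_lim : forall e, 0 < e ->
  exists t0, forall t, (t0 <= t)%N -> 1 - e <= \sum_(i < t) p i.
Hypothesis mean_le1 : forall t, \sum_(i < t) p i * i%:R <= 1.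
Hypothesis mean_lim : forall e, 0 < e ->
  exists t0, forall t, (t0 <= t)%N -> 1 - e <= \sum_(i < t) p i * i%:R.
Hypothesis var_le : forall t, \sum_(i < t) p i * (i%:R - 1) ^+ 2 <= K.
Hypothesis p0_gt0 : 0 < p 0%N.

(** The probability that [n] independent variables with distribution [p] have sum
    [m]. *)
Definition sum_prob (n m : nat) : R := \sum_(e <- compositions n m) weight p e.

(** Powers of [cut t] have the right coefficients below [t], while their moments are
    finite sums; [t] is sent to infinity for fixed [n]. *)
Definition cut (t : nat) : {poly R} := \poly_(i < t) p i.

Lemma sum_prob_cut n m t : (m < t)%N -> sum_prob n m = (cut t ^+ n)`_m.
Proof. exact: coef_compositions. Qed.

Lemma nonneg_cut t : nonneg (cut t).
Proof. by move=> i; rewrite coef_poly; case: ifP. Qed.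

Lemma integ_cut t g : integ (cut t) g = \sum_(i < t) p i * g i.
Proof.
rewrite (@integ_widen _ t) ?size_poly //; apply: eq_bigr => i _.
by rewrite coef_poly ltn_ord.
Qed.

Lemma mass_cut_le1 t : mass (cut t) <= 1.
Proof. by rewrite /mass integ_cut (le_trans _ (mass_le1 t)) // ler_sum // => i; rewrite mulr1. Qed.

Lemma sum_prob_ge0 n m : 0 <= sum_prob n m.
Proof. by rewrite (sum_prob_cut n (ltnSn m)); exact/nonnegX/nonneg_cut. Qed.

Lemma coef_le_mass (F : {poly R}) m : nonneg F -> F`_m <= mass F.
Proof. by move=> F0; rewrite -integ_coef integ_le // => i _; rewrite lern1 leq_b1. Qed.

Lemma sum_prob_le1 n m : sum_prob n m <= 1.
Proof.
rewrite (sum_prob_cut n (ltnSn m)).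
apply: le_trans (coef_le_mass _ (nonnegX _ (nonneg_cut _))) _.
exact: mass_exp_le1 (nonneg_cut _) (mass_cut_le1 _).
Qed.

Lemma sum_prob_mul n1 n2 m1 m2 :
  sum_prob n1 m1 * sum_prob n2 m2 <= sum_prob (n1 + n2) (m1 + m2).
Proof.
pose t := (m1 + m2).+1.
rewrite (@sum_prob_cut _ m1 t) ?(@sum_prob_cut _ m2 t) ?(@sum_prob_cut _ _ t) /t; try lia.
have lt1 : (m1 < (m1 + m2).+1)%N by lia.
rewrite exprD coefM (bigD1 (Ordinal lt1)) //= addKn lerDl.
by apply: sumr_ge0 => i _; apply: mulr_ge0; exact/nonnegX/nonneg_cut.
Qed.

Lemma sum_prob1 i : sum_prob 1 i = p i.
Proof. by rewrite (sum_prob_cut _ (ltnSn i)) expr1 coef_poly ltnSn. Qed.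

Lemma sum_prob_n0 n : sum_prob n 0 = p 0%N ^+ n.
Proof.
rewrite (sum_prob_cut _ (ltnSn 0)) /cut; elim: n => [|n IH]; first by rewrite !expr0 coef1.
by rewrite !exprS coef0M IH coef_poly.
Qed.

Lemma sum_prob_gt0D n1 n2 m1 m2 : 0 < sum_prob n1 m1 -> 0 < sum_prob n2 m2 ->
  0 < sum_prob (n1 + n2) (m1 + m2).
Proof. by move=> H1 H2; apply: lt_le_trans (sum_prob_mul _ _ _ _); exact: mulr_gt0. Qed.

Lemma sum_prob_gt0M n m q : 0 < sum_prob n m -> 0 < sum_prob (q * n) (q * m).
Proof.
move=> H; elim: q => [|q IH]; first by rewrite !mul0n sum_prob_n0 expr0.
by rewrite !mulSn; exact: sum_prob_gt0D.
Qed.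

(** The least positive difference [h] of two attainable values of the same number of
    summands is the span: since [0] is attainable, an attainable [m = q h + rho]
    gives rise to [m + q y] and [q (y + h)], whose difference [rho < h] has to
    vanish. *)
Lemma span_ex : exists h r y, [/\ (0 < h)%N, 0 < sum_prob r y, 0 < sum_prob r (y + h) &
  forall n m, 0 < sum_prob n m -> (h %| m)%N].
Proof.
pose P h := (0 < h)%N && `[< exists r y, 0 < sum_prob r y /\ 0 < sum_prob r (y + h) >].
have exP : exists h, P h.
  have half0 : 0 < 2^-1 :> R by rewrite invr_gt0.
  have [t /(_ t (leqnn t)) Ht] := mean_lim half0.
  have [[a [a0 pa]]|no] := pselect (exists a, (0 < a)%N /\ 0 < p a).
    by exists a; rewrite /P a0; apply/asboolP; exists 1%N, 0%N; rewrite !sum_prob1.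
  move: Ht; rewrite big1 => [|i _]; first by move=> ?; lra.
  have [->|i0] := posnP i; first by rewrite mulr0.
  have [->|ne] := eqVneq (p i) 0; first by rewrite mul0r.
  by case: no; exists i; split=> //; rewrite lt0r ne p_ge0.
have [h /andP[h0 /asboolP[r [y [Hy Hyh]]]] hmin] := ex_minnP exP.
exists h, r, y; split=> // n m Hnm; apply: contraT => nd.
pose q := (m %/ h)%N; have rho : (0 < m %% h)%N by rewrite lt0n.
have H1 : 0 < sum_prob (n + q * r) (m + q * y) by rewrite sum_prob_gt0D ?sum_prob_gt0M.
have H2 : 0 < sum_prob (n + q * r) (0 + q * (y + h)).
  by rewrite sum_prob_gt0D ?sum_prob_gt0M // sum_prob_n0 exprn_gt0.
have := hmin (m %% h)%N; rewrite leqNgt ltn_pmod // => /(_ _)/negP; case=> //.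
rewrite /P rho; apply/asboolP; exists (n + q * r)%N, (0 + q * (y + h))%N; split => //.
have -> : (0 + q * (y + h) + m %% h = m + q * y)%N.
  by rewrite {2}(divn_eq m h) -/q; lia.
exact: H1.
Qed.

Section block.
Variables (h r y : nat).
Hypothesis h_gt0 : (0 < h)%N.
Hypothesis sum_prob_y : 0 < sum_prob r y.
Hypothesis sum_prob_yh : 0 < sum_prob r (y + h).
Hypothesis span : forall n m, 0 < sum_prob n m -> (h %| m)%N.

Let theta : R := Num.min (sum_prob r y) (sum_prob r (y + h)).

Lemma theta_gt0 : 0 < theta.
Proof. by rewrite lt_min sum_prob_y sum_prob_yh. Qed.

Lemma r_gt0 : (0 < r)%N.
Proof.
rewrite lt0n; apply/eqP => r0; move: sum_prob_yh.
by rewrite r0 (sum_prob_cut _ (ltnSn _)) expr0 coef1 addn_eq0 [h == 0%N]gtn_eqF ?andbF ?ltxx.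
Qed.

Lemma integ_coin_part g :
  integ (theta *: ('X^y * toss h) : {poly R}) g = theta / 2 * (g y + g (y + h)%N).
Proof.
rewrite integZ integ_Xn /toss integZ integDl integ1 integ_Xn1 addn0.
by rewrite mulrA.
Qed.

(* The mean of a block without its coin. *)
Let a : R := r%:R - theta * h%:R / 2.

Let spread : R := 2 * (r%:R * K + r%:R ^+ 2) + 2 * (r%:R - a) ^+ 2 + (y%:R - a) ^+ 2.

Section cutoff.
Variable t : nat.
Hypothesis t_large : (y + h < t)%N.

Let F : {poly R} := cut t ^+ r.
Let Q : {poly R} := F - theta *: ('X^y * toss h).

Lemma block_cut : block theta y h Q = F.
Proof. by rewrite /block /Q subrK. Qed.

Lemma coef_coin_part i : (theta *: ('X^y * toss h) : {poly R})`_i =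
  theta / 2 * ((y == i)%:R + (y + h == i)%N%:R).
Proof. by rewrite -integ_coef integ_coin_part. Qed.

(** The removed part takes half of [theta] from each of [y] and [y + h], where [F]
    has mass at least [theta]. *)
Lemma nonneg_rest : nonneg Q.
Proof.
move=> i; rewrite coefB coef_coin_part subr_ge0.
have F0 : 0 <= F`_i by exact/nonnegX/nonneg_cut.
have th0 := theta_gt0.
have [Ey|ny] := eqVneq y i.
  have -> : (y + h == i)%N = false by lia.
  have : theta <= F`_i by rewrite -Ey -sum_prob_cut ?ge_min ?lexx //; lia.
  by rewrite addr0 mulr1; lra.
have [Ey|ny'] := eqVneq (y + h)%N i.
  have : theta <= F`_i by rewrite -Ey -sum_prob_cut ?ge_min ?lexx ?orbT.
  by rewrite add0r mulr1; lra.
by rewrite addr0 mulr0.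
Qed.

Lemma mass_F : mass F = mass Q + theta.
Proof.
rewrite -[in LHS]block_cut /block {1}/mass integDl integ_coin_part -/(mass Q).
by rewrite -[1 + 1]/(2%:R) mulfVK // pnatr_eq0.
Qed.

Lemma mass_F_le1 : mass Q + theta <= 1.
Proof. by rewrite -mass_F; exact: mass_exp_le1 (nonneg_cut _) (mass_cut_le1 _). Qed.

Lemma span_cut i : (cut t)`_i != 0 -> (h %| i)%N.
Proof.
rewrite coef_poly; case: ifP => _; last by rewrite eqxx.
by move=> ne; apply: (@span 1); rewrite sum_prob1 lt0r ne p_ge0.
Qed.

Lemma span_y : (h %| y)%N. Proof. exact: span sum_prob_y. Qed.

Lemma span_rest i : Q`_i != 0 -> (h %| i)%N.
Proof.
rewrite coefB coef_coin_part => ne; apply: contraT => nd.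
have Fi : F`_i = 0.
  by apply/eqP; apply: contraNT nd; apply: nonneg_supp_exp; exact: span_cut.
move: ne; rewrite Fi.
have -> : (y == i) = false by apply: contraNF nd => /eqP <-; exact: span_y.
have -> : (y + h == i)%N = false.
  by apply: contraNF nd => /eqP <-; rewrite dvdn_add ?span_y.
by rewrite addr0 mulr0 subr0 eqxx.
Qed.

Lemma counter_dev : integ (counter theta Q) (dev theta 1) = theta * (1 - mass F).
Proof.
rewrite mass_F /counter integDl integC integZ -['X]expr1 integ_Xn1 /dev; ring.
Qed.

Lemma integ_drift g : integ (drift theta y Q) g =
  integ F g + theta / 2 * (g y - g (y + h)%N).
Proof.
rewrite -[in RHS]block_cut /block /drift !integDl integ_coin_part integZ integ_Xn1.
by field.
Qed.

Lemma drift_dev : integ (drift theta y Q) (dev a 1) =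
  integ F (dev 1 r) - theta * h%:R / 2 * (1 - mass F).
Proof.
rewrite integ_drift.
rewrite (@eq_integ _ _ (dev a 1) (fun i => dev 1 r i + (theta * h%:R / 2) * 1)).
  by rewrite integDr integZr -/(mass F) /dev natrD; field.
by move=> i; rewrite /dev /a; field.
Qed.

Variable eps : R.
Hypothesis eps_ge0 : 0 <= eps.
Hypothesis mass_cut_ge : 1 - eps <= mass (cut t).
Hypothesis mean_cut_ge : 1 - eps <= integ (cut t) (fun i => i%:R).

Lemma mean_cut_le1 : integ (cut t) (fun i => i%:R) <= 1.
Proof. by rewrite integ_cut. Qed.

Lemma dev_cut : `|integ (cut t) (dev 1 1)| <= eps.
Proof.
have -> : integ (cut t) (dev 1 1) = integ (cut t) (fun i => i%:R) - mass (cut t).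
  rewrite (@eq_integ _ _ _ (fun i => i%:R + (-1) * 1)) => [|i].
    by rewrite integDr integZr mulN1r.
  by rewrite /dev; ring.
have := mean_cut_le1; have := mass_cut_le1 t; move: mass_cut_ge mean_cut_ge.
by rewrite ler_norml => *; apply/andP; split; lra.
Qed.

Lemma mass_exp_ge n : 1 - n%:R * eps <= mass (cut t) ^+ n.
Proof.
have M0 := mass_ge0 (nonneg_cut t); have M1 := mass_cut_le1 t.
elim: n => [|n IH]; first by rewrite expr0 mul0r subr0.
have e1 := exprn_ile1 n M0 M1; have e0 := exprn_ge0 n M0.
rewrite exprS -natr1 mulrDl mul1r; move: IH e0 e1 mass_cut_ge eps_ge0.
by move: (mass (cut t)) (n%:R * eps) (eps) => M ne e; move: (M ^+ n) => z *; nra.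
Qed.

Lemma counter_dev_le : `|integ (counter theta Q) (dev theta 1)| <= r%:R * eps.
Proof.
have := mass_exp_ge r; rewrite -massX -/F => mF.
have th1 : theta <= 1 := theta_le1 nonneg_rest mass_F_le1.
have th0 := theta_gt0; have := mass_F_le1; rewrite -mass_F => F1.
rewrite counter_dev ger0_norm; last by rewrite mulr_ge0 ?subr_ge0 // ltW.
apply: le_trans (_ : 1 - mass F <= _); last by lra.
by rewrite ler_piMl ?subr_ge0.
Qed.

Lemma drift_dev_le : `|integ (drift theta y Q) (dev a 1)| <= r%:R * eps * (1 + h%:R).
Proof.
have := mass_exp_ge r; rewrite -massX -/F => mF.
have th1 : theta <= 1 := theta_le1 nonneg_rest mass_F_le1.
have th0 := theta_gt0; have := mass_F_le1; rewrite -mass_F => F1.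
have D : `|integ F (dev 1 r)| <= r%:R * eps.
  apply: le_trans (dev_pow1 r 1 (nonneg_cut t) (mass_cut_le1 t)) _.
  by rewrite ler_wpM2l // dev_cut.
rewrite drift_dev (le_trans (ler_normB _ _)) // [leRHS]mulrDr mulr1 lerD //.
have hR : 0 <= h%:R :> R by [].
have F1' : 0 <= 1 - mass F by rewrite subr_ge0.
rewrite ger0_norm; last by rewrite !mulr_ge0 // ltW.
have small : 1 - mass F <= r%:R * eps by move: mF; lra.
have half : theta * h%:R / 2 <= h%:R.
  have := mulr_ge0 (_ : 0 <= 1 - theta) hR; rewrite subr_ge0 th1 => /(_ isT).
  by move: (theta) (h%:R : R) hR => u v v0; lra.
by rewrite mulrC; apply: ler_pM => //; rewrite !mulr_ge0 // ltW.
Qed.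

Lemma drift_spread : eps <= 1 ->
  integ (drift theta y Q) (fun i => dev a 1 i ^+ 2) <= spread.
Proof.
move=> eps1; rewrite integ_drift.
have th1 : theta <= 1 := theta_le1 nonneg_rest mass_F_le1.
have th0 := theta_gt0; have := mass_F_le1; rewrite -mass_F => F1.
have F0 : nonneg F by exact/nonnegX/nonneg_cut.
have FV : integ F (fun i => dev 1 r i ^+ 2) <= r%:R * K + r%:R ^+ 2.
  apply: le_trans (dev_pow2 r 1 (nonneg_cut t) (mass_cut_le1 t)) _.
  apply: lerD.
    rewrite ler_wpM2l // integ_cut (le_trans _ (var_le t)) // ler_sum // => i _.
    by rewrite /dev mul1r.
  rewrite exprMn ler_piMr ?sqr_ge0 // -real_normK ?num_real // exprn_ile1 //.
  exact: le_trans dev_cut eps1.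
have FA : integ F (fun i => dev a 1 i ^+ 2) <=
    2 * (r%:R * K + r%:R ^+ 2) + 2 * (r%:R - a) ^+ 2.
  apply: (@le_trans _ _ (integ F (fun i => 2 * dev 1 r i ^+ 2 + 2 * (r%:R - a) ^+ 2 * 1))).
    apply: integ_le => // i _; rewrite /dev !mulr1 mul1r.
    have := sqr_ge0 (i%:R - r%:R - (r%:R - a)); rewrite !expr2; nra.
  rewrite integDr !integZr -/(mass F) lerD ?ler_wpM2l //.
  by rewrite ler_piMr // mulr_ge0 ?sqr_ge0.
rewrite /spread lerD // /dev !mul1r natrD.
have := sqr_ge0 (y%:R + h%:R - a); have := sqr_ge0 (y%:R - a).
by move: (_ ^+ 2) (_ ^+ 2) => u v; nra.
Qed.

End cutoff.

(** For given [N] and [m] the cutoff can be taken so far out that the error of the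
    truncated mean, multiplied by the number of summands, is at most
    [sqrt N]. *)
Lemma cutoff_ex N m : (0 < N)%N -> exists t,
  let Q := cut t ^+ r - theta *: ('X^y * toss h) in
  [/\ sum_prob (r * N) m = (block theta y h Q ^+ N)`_m, nonneg Q,
      mass Q + theta <= 1, (forall i, Q`_i != 0 -> (h %| i)%N) &
   [/\ N%:R * integ (counter theta Q) (dev theta 1) ^+ 2 <= 1,
       N%:R * integ (drift theta y Q) (dev a 1) ^+ 2 <= 1,
       integ (drift theta y Q) (fun i => dev a 1 i ^+ 2) <= spread &
       3 / 4 <= (mass Q + theta) ^+ N]].
Proof.
move=> N0; have NR : 1 <= N%:R :> R by rewrite ler1n.
have rR : 1 <= r%:R :> R by rewrite ler1n r_gt0.
have hR : 1 <= h%:R :> R by rewrite ler1n.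
have den0 : 1 <= 4 * (r%:R * (1 + h%:R) * N%:R) :> R.
  have : 1 <= r%:R * (1 + h%:R) :> R by nra.
  by move: (r%:R * (1 + h%:R)) => z z1; nra.
(* The errors of all means are at most [r * eps * (1 + h)], which is [1 / (4 N)]. *)
pose eps : R := (4 * (r%:R * (1 + h%:R) * N%:R))^-1.
have eps0 : 0 < eps by rewrite invr_gt0; lra.
have eps1 : eps <= 1 by rewrite invf_le1; lra.
have Eeps : N%:R * (r%:R * eps * (1 + h%:R)) = 1 / 4.
  by rewrite /eps; field; do ![apply/andP; split]; rewrite gt_eqF //; lra.
have [t1 Ht1] := mass_lim eps0; have [t2 Ht2] := mean_lim eps0.
pose t := maxn (maxn t1 t2) (maxn (y + h).+1 m.+1).
have t1t : (t1 <= t)%N by rewrite !leq_max leqnn.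
have t2t : (t2 <= t)%N by rewrite !leq_max leqnn orbT.
have tyh : (y + h < t)%N by rewrite !leq_max leqnn !orbT.
have tm : (m < t)%N by rewrite !leq_max leqnn !orbT.
have mass_t : 1 - eps <= mass (cut t).
  by rewrite /mass integ_cut; under eq_bigr do rewrite mulr1; exact: Ht1.
have mean_t : 1 - eps <= integ (cut t) (fun i => i%:R) by rewrite integ_cut; exact: Ht2.
have e0 := ltW eps0.
have bound (x : R) : `|x| <= r%:R * eps * (1 + h%:R) -> N%:R * x ^+ 2 <= 1.
  move=> xle; have x0 := normr_ge0 x; rewrite -real_normK ?num_real // expr2.
  have : N%:R * `|x| <= 1 / 4 by rewrite -Eeps ler_wpM2l.
  move: (`|x|) x0 xle => z z0 zle.
  have : z <= 1 / 4 by apply: le_trans zle _; rewrite -Eeps ler_peMl // !mulr_ge0 //; lra.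
  nra.
exists t => Q; split.
- by rewrite (block_cut t) -exprM -sum_prob_cut.
- exact: nonneg_rest.
- exact: mass_F_le1.
- exact: span_rest.
split.
- apply: bound; apply: le_trans (counter_dev_le tyh e0 mass_t) _.
  by rewrite ler_peMr ?mulr_ge0 //; lra.
- exact: bound (drift_dev_le tyh e0 mass_t mean_t).
- exact: (drift_spread tyh mass_t mean_t eps1).
- rewrite -(mass_F t) massX -exprM.
  apply: le_trans _ (mass_exp_ge e0 mass_t _).
  have : N%:R * (r%:R * eps) <= 1 / 4.
    by rewrite -Eeps ler_wpM2l // ler_peMr ?mulr_ge0 //; lra.
  rewrite natrM; lra.
Qed.

Lemma sum_prob_upper N m : (0 < N)%N ->
  sum_prob (r * N) m <= (Num.sqrt (2 / theta) + 12 / theta ^+ 2) / Num.sqrt N%:R.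
Proof.
move=> N0; have [t [-> Q0 QM _ [e1 _ _ _]]] := cutoff_ex m N0.
exact: (block_upper y theta_gt0 h_gt0 Q0 QM m N0 e1).
Qed.

Lemma sum_prob_lower : exists2 c, 0 < c & exists N0, forall N m, (N0 <= N)%N -> (0 < N)%N ->
  (h %| m)%N -> `|m%:R - N%:R * r%:R| <= r%:R :> R -> c / Num.sqrt N%:R <= sum_prob (r * N) m.
Proof.
pose L : R := 2 * (spread + 4).
pose K' : R := 24 * (r%:R ^+ 2 + L + h%:R ^+ 2 * L) / theta.
exists (expR (- (2 * K')) / 8); first by rewrite divr_gt0 ?expR_gt0.
have [N0 HN0] : exists N0 : nat, 4 * L / theta ^+ 2 + 32 * (K' + 1) / theta <= N0%:R.
  exists (Num.bound `|4 * L / theta ^+ 2 + 32 * (K' + 1) / theta|).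
  by apply: le_trans (ler_norm _) _; apply/ltW/archi_boundP.
exists N0 => N m N0N N_gt0 hm near.
have [t [-> Q0 QM Qspan [e1 e2 e3 e4]]] := cutoff_ex m N_gt0.
have S0 : 0 <= spread.
  apply: le_trans e3; apply: integ_ge0 => [|i]; last exact: sqr_ge0.
  exact: nonneg_drift theta_gt0 _ Q0.
apply: (block_lower theta_gt0 h_gt0 Q0 QM (r := r%:R) (a := a)) => //.
- exact: span_y.
- by rewrite /a subrK.
- lra.
- by apply: le_trans HN0 _; rewrite ler_nat.
Qed.

Lemma sqrt_blocks n : (r <= n)%N ->
  (Num.sqrt (n %/ r)%N%:R)^-1 <= Num.sqrt (2 * r%:R) / Num.sqrt n%:R :> R.
Proof.
move=> rn; have q0 : (0 < n %/ r)%N by rewrite divn_gt0 ?r_gt0.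
have n0 : (0 < n)%N by apply: leq_trans rn; exact: r_gt0.
have sq : 0 < Num.sqrt (n %/ r)%N%:R :> R by rewrite sqrtr_gt0 ltr0n.
have sn : 0 < Num.sqrt n%:R :> R by rewrite sqrtr_gt0 ltr0n.
rewrite ler_pdivlMr // mulrC ler_pdivrMr // -sqrtrM ?mulr_ge0 // ler_wsqrtr //.
rewrite -!natrM ler_nat {1}(divn_eq n r); have := ltn_pmod n r_gt0; nia.
Qed.

(** The remaining [n %% r] summands cannot increase the largest point probability. *)
Lemma sum_prob_upper_all : exists2 c, 0 <= c & forall n m, (0 < n)%N ->
  sum_prob n m <= c / Num.sqrt n%:R :> R.
Proof.
set u := Num.sqrt (2 / theta) + 12 / theta ^+ 2.
have u0 : 0 <= u.
  by rewrite addr_ge0 ?sqrtr_ge0 // divr_ge0 // sqr_ge0.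
exists (u * Num.sqrt (2 * r%:R) + Num.sqrt r%:R).
  by rewrite addr_ge0 ?mulr_ge0 ?sqrtr_ge0.
move=> n m n0; have sn : 0 < Num.sqrt n%:R :> R by rewrite sqrtr_gt0 ltr0n.
have [nr|rn] := ltnP n r.
  apply: le_trans (sum_prob_le1 _ _) _; rewrite ler_pdivlMr // mul1r.
  rewrite -[leLHS]add0r lerD ?mulr_ge0 ?sqrtr_ge0 // ler_wsqrtr // ler_nat ltnW //.
have q0 : (0 < n %/ r)%N by rewrite divn_gt0 ?r_gt0.
have Hq j : sum_prob (r * (n %/ r)) j <= u * (Num.sqrt (2 * r%:R) / Num.sqrt n%:R).
  by apply: le_trans (sum_prob_upper _ q0) _; rewrite ler_wpM2l // sqrt_blocks.
apply: (@le_trans _ _ (u * (Num.sqrt (2 * r%:R) / Num.sqrt n%:R))); last first.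
  by rewrite [leRHS]mulrDl [leLHS]mulrA lerDl divr_ge0 ?sqrtr_ge0.
rewrite [n in sum_prob n](divn_eq n r) addnC (mulnC _ r) (sum_prob_cut _ (ltnSn m)) exprD coefM.
set b := u * _; apply: (@le_trans _ _ (\sum_(i < m.+1) (cut m.+1 ^+ (n %% r))`_i * b)).
  apply: ler_sum => i _; rewrite ler_wpM2l //; first exact/nonnegX/nonneg_cut.
  by rewrite -sum_prob_cut ?Hq // ltnS leq_subr.
rewrite -mulr_suml ler_piMl //; first by rewrite /b mulr_ge0 // divr_ge0 ?sqrtr_ge0.
apply: le_trans (mass_exp_le1 (n %% r) (nonneg_cut m.+1) (mass_cut_le1 m.+1)).
set H := _ ^+ _; have H0 : nonneg H by exact/nonnegX/nonneg_cut.
rewrite /mass (@integ_widen _ (maxn (size H) m.+1)) ?leq_maxl //.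
rewrite -(big_mkord xpredT (fun i => H`_i)) -(big_mkord xpredT (fun i => H`_i * 1)).
rewrite [leRHS](big_cat_nat _ (n := m.+1)) ?leq_maxr //=.
under [X in _ <= X + _]eq_bigr do rewrite mulr1.
by rewrite lerDl sumr_ge0 // => i _; rewrite mulr1.
Qed.

(** Let the remaining [n %% r] summands be zero, which has probability at least
    [p 0 ^ r]. *)
Lemma sum_prob_lower_all : exists2 c, 0 < c & exists n0, forall n, (n0 <= n)%N -> (0 < n)%N ->
  0 < sum_prob n n.-1 -> c / Num.sqrt n%:R <= sum_prob n n.-1 :> R.
Proof.
have [c c0 [N0 HN]] := sum_prob_lower.
have pr0 : 0 < p 0%N ^+ r by rewrite exprn_gt0.
exists (p 0%N ^+ r * c); first exact: mulr_gt0.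
exists (r * N0.+1)%N => n large n0 pos.
have qN : (N0.+1 <= n %/ r)%N by rewrite leq_divRL ?r_gt0 // mulnC.
have q0 : (0 < n %/ r)%N by apply: leq_trans qN.
have := HN _ n.-1 (ltnW qN) q0 (span pos).
have near : `|n.-1%:R - (n %/ r)%N%:R * r%:R| <= r%:R :> R.
  have E : n%:R = (n %/ r)%N%:R * r%:R + (n %% r)%N%:R :> R.
    by rewrite -natrM -natrD -divn_eq.
  have En : n%:R = n.-1%:R + 1 :> R by rewrite natr1 prednK.
  have : (n %% r)%N%:R + 1 <= r%:R :> R by rewrite natr1 ler_nat ltn_pmod ?r_gt0.
  have : 0 <= (n %% r)%N%:R :> R by [].
  have : 1 <= r%:R :> R by rewrite ler1n r_gt0.
  move=> *; rewrite ler_norml; apply/andP; split; lra.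
move=> /(_ near) low.
have := sum_prob_mul (r * (n %/ r)) (n %% r) n.-1 0.
rewrite addn0 [(r * _)%N]mulnC -divn_eq mulnC; apply: le_trans.
rewrite -mulrA mulrC; apply: ler_pM.
- by rewrite divr_ge0 ?sqrtr_ge0 // ltW.
- exact: ltW.
- apply: le_trans low; rewrite ler_wpM2l ?(ltW c0) // lef_pV2 ?posrE ?sqrtr_gt0 ?ltr0n //.
  by rewrite ler_wsqrtr // ler_nat leq_div.
- rewrite sum_prob_n0; apply: ler_wiXn2l; first exact: ltW.
    by rewrite -sum_prob1 sum_prob_le1.
  by rewrite ltnW // ltn_pmod // r_gt0.
Qed.

End block.

(** Split off the first summand: what remains is at most the second moment of [p]
    times the largest point probability for [n - 1] summands, of the same order
    [1 / sqrt n] as the lower bound for the event. The finitely many small [n] are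
    covered by their own quotients. *)
Lemma head_moment : exists2 c, 0 <= c & forall n, (0 < n)%N -> 0 < sum_prob n n.-1 ->
  \sum_(e <- compositions n n.-1) weight p e * (head 0%N e ^ 2)%N%:R <= c * sum_prob n n.-1.
Proof.
have [h [r [y [h0 Hy Hyh sp]]]] := span_ex.
have [cu cu0 Hu] := sum_prob_upper_all h0 Hy Hyh sp.
have [cl cl0 [n0 Hl]] := sum_prob_lower_all h0 Hy Hyh sp.
have K0 : 0 <= K by apply: le_trans (var_le 0); rewrite big_ord0.
have second t : \sum_(i < t) p i * (i ^ 2)%N%:R <= K + 2.
  apply: le_trans (_ : \sum_(i < t) p i * (i%:R - 1) ^+ 2 + 2 * \sum_(i < t) p i * i%:R <= _).
    rewrite mulr_sumr -big_split; apply: ler_sum => i _ /=.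
    by rewrite natrX; have := p_ge0 i; nra.
  by apply: lerD => //; have := mean_le1 t; lra.
have moment n b : 0 <= b -> (forall m, sum_prob n m <= b) ->
    \sum_(e <- compositions n.+1 n) weight p e * (head 0%N e ^ 2)%N%:R <= (K + 2) * b.
  move=> b0 Hb; rewrite coef_compositions_head.
  apply: (@le_trans _ _ (\sum_(i < n.+1) p i * (i ^ 2)%N%:R * b)).
    by apply: ler_sum => i _; rewrite ler_wpM2l ?mulr_ge0 //; exact: Hb.
  by rewrite -mulr_suml ler_wpM2r.
pose small n := if 0 < sum_prob n n.-1 then (K + 2) / sum_prob n n.-1 else 0.
have small0 n : 0 <= small n.
  by rewrite /small; case: ifP => // H; rewrite divr_ge0 ?addr_ge0 // ltW.
(* The factor [Num.sqrt 2] passes from [n] to [n + 1] summands. *)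
pose big := (K + 2) * (cu * Num.sqrt 2 / cl).
have big0 : 0 <= big.
  by rewrite !mulr_ge0 ?addr_ge0 ?invr_ge0 ?sqrtr_ge0 // ltW.
exists (\sum_(i < n0.+2) small i + big).
  by rewrite addr_ge0 // sumr_ge0.
move=> [//|n] _ /= pos.
have [lt|ge] := ltnP n.+1 n0.+2.
  apply: (@le_trans _ _ (small n.+1 * sum_prob n.+1 n)).
    rewrite /small /= pos divfK ?gt_eqF // -[leRHS]mulr1.
    by apply: moment => // m; exact: sum_prob_le1.
  rewrite ler_wpM2r ?sum_prob_ge0 // (bigD1 (Ordinal lt)) //= -addrA lerDl addr_ge0 //.
  by rewrite sumr_ge0.
have n_gt0 : (0 < n)%N by lia.
apply: (@le_trans _ _ ((K + 2) * (cu / Num.sqrt n%:R))).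
  apply: moment => [|m]; last exact: Hu.
  by rewrite divr_ge0 ?sqrtr_ge0.
apply: (@le_trans _ _ (big * sum_prob n.+1 n)); last first.
  by rewrite ler_wpM2r ?sum_prob_ge0 // lerDr sumr_ge0.
rewrite /big -mulrA ler_wpM2l ?addr_ge0 //.
have low := Hl n.+1 (ltac:(lia)) isT pos.
have sn : 0 < Num.sqrt n%:R :> R by rewrite sqrtr_gt0 ltr0n.
have sn1 : 0 < Num.sqrt n.+1%:R :> R by rewrite sqrtr_gt0 ltr0n.
apply: (@le_trans _ _ (cu * Num.sqrt 2 / cl * (cl / Num.sqrt n.+1%:R))); last first.
  by rewrite ler_wpM2l // divr_ge0 ?mulr_ge0 ?sqrtr_ge0 // ltW.
rewrite mulrA divfK ?gt_eqF // -!mulrA ler_wpM2l //.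
rewrite ler_pdivlMr // mulrC ler_pdivrMr // -sqrtrM // ler_wsqrtr //.
by rewrite -natrM ler_nat; lia.
Qed.

End local_limit.

(** * From sums of independent variables back to trees *)

(** The probability that the tree has [n] vertices; see [size_event_prob]. *)
Definition tree_mass (R : realType) (p : nat -> R) (n : nat) : R :=
  \sum_(d <- tree_codes n) weight p d.

(** By the cycle lemma [tree_mass p n] is [sum_prob p n n.-1 / n], and the weighted
    sum of squared degrees is the moment of the head. *)
Lemma weighted_trees_le (R : realType) (p : nat -> R) (c : R) :
  (forall i, 0 <= p i) -> 0 <= c ->
  (forall n, (0 < n)%N -> 0 < sum_prob p n n.-1 ->
    \sum_(e <- compositions n n.-1) weight p e * (head 0%N e ^ 2)%N%:R <= c * sum_prob p n n.-1) ->
  forall n k, (0 < n)%N -> (0 < k)%N -> 0 < tree_mass p n ->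
  \sum_(d <- tree_codes n) weight p d *
     (size d + \sum_(1 <= i < k) size (pairs i (k - i) d))%N%:R
  <= (1 + c) * n%:R * k%:R * tree_mass p n.
Proof.
move=> p0 c0 head_le n k n0 k0 q0; have nR : 0 < n%:R :> R by rewrite ltr0n.
have rotw r e : weight p (rot r e) = weight p e.
  by apply: perm_weight; rewrite perm_rot.
have Eh : sum_prob p n n.-1 = n%:R * tree_mass p n by apply: cycle_lemma.
have Es : \sum_(d <- tree_codes n) weight p d * (sumsq d)%:R =
    \sum_(e <- compositions n n.-1) weight p e * (head 0%N e ^ 2)%N%:R.
  have rots r e : weight p (rot r e) * (sumsq (rot r e))%:R = weight p e * (sumsq e)%:R.
    by rewrite rotw /sumsq (perm_big e) //= perm_rot.
  have := cycle_lemma n0 rots; rewrite head_sumsq => /mulfI -> //.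
  by rewrite gt_eqF.
apply: le_trans (weighted_pairs_le p0 n k0) _; rewrite -/(tree_mass p n) Es.
have H := head_le n n0; rewrite Eh in H.
have kR : 1 <= k%:R :> R by rewrite ler1n.
apply: (@le_trans _ _ (n%:R * tree_mass p n * k%:R + k%:R * (c * (n%:R * tree_mass p n)))).
  apply: lerD; last by rewrite ler_wpM2l // H // mulr_gt0.
  by rewrite ler_peMr // mulr_ge0 // ltW.
by rewrite le_eqVlt; apply/orP; left; apply/eqP; ring.
Qed.

(** * Moments of the offspring distribution *)

Definition mass_at (R : realType) (mu : probability nat R) (i : nat) : R :=
  fine (mu [set i]).

Lemma mass_at_ge0 (R : realType) (mu : probability nat R) i : 0 <= mass_at mu i.
Proof. exact: fine_ge0. Qed.

Lemma mass_atE (R : realType) (mu : probability nat R) i :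
  (mass_at mu i)%:E = mu [set i].
Proof. by rewrite fineK // fin_num_measure. Qed.

Section moments.
Context {R : realType} {d : measure_display} {S : measurableType d}
  (Q : probability S R) (xi : {RV Q >-> nat}).
Let mu : probability nat R := distribution Q xi.
Let p := mass_at mu.

(** Split the space according to the value of [xi]. *)
Lemma integral_discrete (g : nat -> R) : (forall i, 0 <= g i) ->
  (\int[Q]_s (g (xi s))%:E = \sum_(0 <= i <oo) (p i * g i)%:E)%E.
Proof.
move=> g0; have mg : measurable_fun setT (EFin \o (g \o xi)).
  apply/measurable_EFinP; apply: (measurableT_comp (f := g)); last exact: measurable_funP.
  by [].
have mF i : measurable (xi @^-1` [set i]) by exact: measurable_funPTI.
have cover : \bigcup_i xi @^-1` [set i] = setT.
  by rewrite -subTset => s _; exists (xi s).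
rewrite -cover ge0_integral_bigcup ?cover //; last exact: trivIset_preimage1.
  apply: eq_eseriesr => i _.
  rewrite (eq_integral (cst (g i)%:E)); last by move=> s; rewrite inE => /= ->.
  rewrite integral_cst // EFinM muleC; congr (_ * _)%E.
  by rewrite /p mass_atE.
by move=> s _; rewrite lee_fin.
Qed.

Lemma partial_sum_le (g : nat -> R) (M : R) : (forall i, 0 <= g i) ->
  (\int[Q]_s (g (xi s))%:E <= M%:E)%E -> forall t, \sum_(i < t) p i * g i <= M.
Proof.
move=> g0 + t; rewrite integral_discrete //; rewrite -lee_fin; apply: le_trans.
rewrite -(big_mkord xpredT (fun i => p i * g i)) -sumEFin.
by apply: nneseries_lim_ge => i _ _; rewrite lee_fin mulr_ge0 ?mass_at_ge0.
Qed.

Lemma partial_sum_lim (g : nat -> R) (M : R) : (forall i, 0 <= g i) ->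
  (\int[Q]_s (g (xi s))%:E = M%:E)%E -> forall e, 0 < e ->
  exists t0, forall t, (t0 <= t)%N -> M - e <= \sum_(i < t) p i * g i.
Proof.
move=> g0; rewrite integral_discrete // => lim e e0.
have : (fun n => \sum_(0 <= i < n) (p i * g i)%:E)%E @ \oo --> M%:E.
  rewrite -lim; apply: is_cvg_nneseries => i _ _.
  by rewrite lee_fin mulr_ge0 ?mass_at_ge0.
move/fine_cvg/cvgrPdist_le => /(_ e e0)[t0 _ Ht]; exists t0 => t tt0.
have := Ht t tt0; rewrite /= sumEFin /= big_mkord ler_norml => /andP[_].
by rewrite lerBlDr lerBlDl.
Qed.

Hypothesis mean1 : ('E_Q[fun s => (xi s)%:R] = 1)%E.
Hypothesis var_gt0 : (0 < 'V_Q[fun s => (xi s)%:R])%E.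
Hypothesis var_fin : ('V_Q[fun s => (xi s)%:R] < +oo)%E.

Lemma integral_mean : (\int[Q]_s (xi s)%:R%:E = 1%:E)%E.
Proof. by move: mean1; rewrite unlock. Qed.

Lemma variance_integral :
  ('V_Q[fun s => (xi s)%:R] = \int[Q]_s (((xi s)%:R - 1) ^+ 2)%:E)%E.
Proof.
rewrite /variance unlock mean1 /= unlock; apply: eq_integral => s _ /=.
by rewrite expr2.
Qed.

Lemma integral_mass : (\int[Q]_s 1%:E = 1%:E)%E.
Proof. by rewrite integral_cst // mul1e; exact: (probability_setT Q). Qed.

Lemma mass_sum_le1 t : \sum_(i < t) p i <= 1.
Proof.
have := @partial_sum_le (fun=> 1) 1 (fun=> ler01) _ t.
by under eq_bigr do rewrite mulr1; apply; rewrite integral_mass.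
Qed.

Lemma mean_sum_le1 t : \sum_(i < t) p i * i%:R <= 1.
Proof. by apply: (partial_sum_le (g := fun i => i%:R)) => //; rewrite integral_mean. Qed.

(** Otherwise [xi >= 1] almost surely, so mean one forces [xi = 1] almost surely and
    the variance vanishes. *)
Lemma mass_at0_gt0 : 0 < p 0%N.
Proof.
rewrite lt0r mass_at_ge0 andbT; apply/eqP => p00.
have other i : (1 < i)%N -> p i = 0.
  move=> i1; apply/eqP; rewrite eq_le mass_at_ge0 andbT leNgt; apply/negP => pi.
  (* The partial sums of [p j * (j - 1)] contain [p i] but stay below [p i / 2]. *)
  have half0 : 0 < p i / 2 by rewrite divr_gt0.
  have [t0 Ht] := partial_sum_lim (fun=> ler01) integral_mass half0.
  pose t := maxn t0 i.+1; have := Ht t (leq_maxl _ _).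
  have it : (i < t)%N by exact: leq_maxr.
  have := mean_sum_le1 t.
  have : p i <= \sum_(j < t) p j * (j%:R - 1).
    rewrite (bigD1 (Ordinal it)) //= -[leLHS]addr0 lerD //.
      by rewrite ler_peMr ?mass_at_ge0 // lerBrDr -[1 + 1]/(2%:R) ler_nat.
    apply: sumr_ge0 => j _; have [->|j0] := posnP j; first by rewrite p00 mul0r.
    by rewrite mulr_ge0 ?mass_at_ge0 // subr_ge0 ler1n.
  under eq_bigr do rewrite mulrBr.
  rewrite big_split /= sumrN; lra.
move: var_gt0; rewrite variance_integral (integral_discrete (g := fun i => (i%:R - 1) ^+ 2)).
  rewrite eseries0 ?ltxx // => i _ _.
  case: i => [|[|i]]; first by rewrite p00 mul0r.
    by rewrite subrr expr0n mulr0.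
  by rewrite other // mul0r.
by move=> i; exact: sqr_ge0.
Qed.

Lemma offspring_bound : exists2 C : R, 0 <= C &
  forall n k, (0 < n)%N -> (0 < k)%N -> 0 < tree_mass p n ->
  \sum_(d <- tree_codes n) weight p d *
     (size d + \sum_(1 <= i < k) size (pairs i (k - i) d))%N%:R
  <= C * n%:R * k%:R * tree_mass p n.
Proof.
have p0 : forall i, 0 <= p i by exact: mass_at_ge0.
pose K := fine 'V_Q[fun s => (xi s)%:R].
have KE : 'V_Q[fun s => (xi s)%:R]%E = K%:E by rewrite fineK // gt0_fin_numE.
have var_le t : \sum_(i < t) p i * (i%:R - 1) ^+ 2 <= K.
  apply: (partial_sum_le (g := fun i => (i%:R - 1) ^+ 2)); first by move=> i; exact: sqr_ge0.
  by rewrite -variance_integral KE.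
have mass_lim e : 0 < e -> exists t0, forall t, (t0 <= t)%N -> 1 - e <= \sum_(i < t) p i.
  move=> e0; have [t0 Ht] := partial_sum_lim (fun=> ler01) integral_mass e0.
  by exists t0 => t /Ht; under eq_bigr do rewrite mulr1.
have [c c0 Hc] := head_moment p0 mass_sum_le1 mass_lim mean_sum_le1
  (partial_sum_lim (fun i => ler0n R i) integral_mean) var_le mass_at0_gt0.
exists (1 + c); first by rewrite addr_ge0.
by move=> n k; exact: weighted_trees_le.
Qed.

End moments.

(** * The random tree *)

Section random_tree.
Context {R : realType} {d : measure_display} {T : measurableType d}
  (P : probability T R) (X : seq nat -> {RV P >-> nat}) (mu : probability nat R).
Hypothesis X_mu : forall u, distribution P (X u) =1 mu.
Hypothesis X_indep : mutually_independent X.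
Let p := mass_at mu.

(** Empty unless [e] encodes a tree, so that it is measurable for every [e]. *)
Definition code_event (e : seq nat) : set T :=
  [set w | forest_code 1 e /\ obeys (fun u => X u w) [:: [::]] e].

Lemma code_eventE e : forest_code 1 e ->
  code_event e = \bigcap_(u in [set` tree_nodes e]) (X u @^-1` [set code_degree e u]).
Proof.
move=> le; have oe := obeys_code_degree le.
rewrite eqEsubset; split=> w /=.
  move=> [_ ow] u ue.
  have : map (fun u => X u w) (tree_nodes e) = map (code_degree e) (tree_nodes e).
    by rewrite ow oe.
  by move/eq_in_map => /(_ u ue).
move=> H; split=> //; rewrite /obeys -[RHS]oe; apply/eq_in_map => u ue.
exact: H.
Qed.

Lemma measurable_code_event e : measurable (code_event e).
Proof.
have [le|nle] := boolP (forest_code 1 e); last first.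
  by rewrite (_ : code_event e = set0) // -subset0 => w [] /(negP nle).
rewrite code_eventE //; apply: fin_bigcap_measurable => [|u _].
  exact: finite_seq.
exact: measurable_funPTI.
Qed.

(** The numbers of children of different vertices are independent. *)
Lemma code_event_prob e : forest_code 1 e -> P (code_event e) = (weight p e)%:E.
Proof.
move=> le; rewrite code_eventE // X_indep ?uniq_tree_nodes //.
rewrite /weight -[in RHS](obeys_code_degree le) big_map -prodEFin.
apply: eq_bigr => u _; rewrite /p mass_atE -(X_mu u).
by [].
Qed.

Lemma GW_size_eventP n w : GW_size_event X n w <->
  exists2 e, e \in tree_codes n & code_event e w.
Proof.
split=> [/obeys_ex[e [se le oe]]|[e]].
  by exists e => //; rewrite mem_tree_codes se eqxx.
rewrite mem_tree_codes => /andP[/eqP <- _] [le oe]; rewrite /GW_size_event /= /GW_tree.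
rewrite (family_tree_nodes le oe) -(size_tree_nodes le).
exact/seq_card_eq/uniq_tree_nodes.
Qed.

Lemma measurable_GW_size_event n : measurable (GW_size_event X n).
Proof.
have -> : GW_size_event X n = \bigcup_(e in [set` tree_codes n]) code_event e.
  rewrite eqEsubset; split=> w.
    by move=> /GW_size_eventP[e en ew]; exists e.
  by move=> [e en ew]; apply/GW_size_eventP; exists e.
apply: fin_bigcup_measurable => [|e _]; first exact: finite_seq.
exact: measurable_code_event.
Qed.

(** The event is the disjoint union of the code events, and on each of them the tree
    is fixed. The statement includes the probability of the event, as the case
    [Y = 1]. *)
Lemma integral_size_event n (Y : T -> \bar R) (y : seq nat -> R) :
  (forall e, 0 <= y e) ->
  (forall e w, e \in tree_codes n -> code_event e w -> Y w = (y e)%:E) ->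
  (\int[P]_(w in GW_size_event X n) Y w =
   (\sum_(e <- tree_codes n) weight p e * y e)%:E)%E.
Proof.
move=> y0 Yy; have mA := measurable_GW_size_event n.
rewrite (eq_integral (fun w => \sum_(e <- tree_codes n) (y e)%:E * (\1_(code_event e) w)%:E)%E);
  last first.
  move=> w; rewrite inE => /GW_size_eventP[e en ew].
  rewrite (Yy e w en ew) (bigD1_seq e) ?uniq_tree_codes //= indicE mem_set // mule1.
  rewrite big_seq_cond big1 ?adde0 // => f /andP[fn nef].
  rewrite indicE memNset ?mule0 // => -[lf of_]; case/eqP: nef; case: ew => le oe.
  exact: code_inj lf le of_ oe.
have mi e : measurable_fun (GW_size_event X n) (EFin \o \1_(code_event e) : T -> \bar R).
  by apply/measurable_EFinP/measurable_indic; exact: measurable_code_event.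
rewrite ge0_integral_sum //; last 2 first.
- by move=> e; apply: measurable_funeM; exact: mi.
- by move=> e w _; rewrite mule_ge0 // lee_fin.
rewrite -sumEFin; apply: eq_big_seq => e en.
rewrite ge0_integralZl_EFin //; last exact: mi.
rewrite integral_indic //; last exact: measurable_code_event.
rewrite setIidl; last by move=> w ew; apply/GW_size_eventP; exists e.
rewrite EFinM [RHS]muleC; congr (_ * _)%E; apply: code_event_prob.
by move: en; rewrite mem_tree_codes => /andP[].
Qed.

Lemma size_event_prob n : P (GW_size_event X n) = (tree_mass p n)%:E.
Proof.
have := integral_size_event (n := n) (Y := cst 1%E) (y := fun=> 1)
  (fun=> ler01) (fun _ _ _ _ => erefl).
rewrite integral_cst ?mul1e; last exact: measurable_GW_size_event.
by move=> ->; congr (_%:E); apply: eq_bigr => e _; rewrite mulr1.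
Qed.

Lemma cond_pairs_le (C : R) n k : (0 < k)%N ->
  \sum_(e <- tree_codes n) weight p e *
     (size e + \sum_(1 <= i < k) size (pairs i (k - i) e))%N%:R
    <= C * tree_mass p n ->
  (0 < P (GW_size_event X n))%E ->
  (cond_expectation P (GW_size_event X n) (fun w => num_pairs R k (GW_tree X w))
   <= C%:E)%E.
Proof.
move=> k0 HC; rewrite /cond_expectation size_event_prob lte_fin => q0.
pose y e : R := fine (num_pairs R k [set` tree_nodes e]).
have y0 e : 0 <= y e by apply: fine_ge0; exact: num_pairs_ge0.
rewrite (integral_size_event y0); last first.
  move=> e w en [le oe]; rewrite /GW_tree (family_tree_nodes le oe) /y fineK //.
  rewrite ge0_fin_numE; last exact: num_pairs_ge0.
  by apply: le_lt_trans (num_pairs_le R le k0) _; rewrite ltry.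
rewrite inver gt_eqF // lee_pdivrMr // -EFinM lee_fin; apply: le_trans HC.
rewrite !big_seq; apply: ler_sum => e; rewrite mem_tree_codes => /andP[_ le].
rewrite ler_wpM2l ?weight_ge0 //; first exact: mass_at_ge0.
rewrite -lee_fin /y fineK ?num_pairs_le //.
rewrite ge0_fin_numE; last exact: num_pairs_ge0.
by apply: le_lt_trans (num_pairs_le R le k0) _; rewrite ltry.
Qed.

End random_tree.

Theorem theorem1p1 (R : realType) :
  exists C : probability nat R -> R,
  forall (d0 : measure_display) (S : measurableType d0) (Q : probability S R)
    (xi : {RV Q >-> nat}),
  ('E_Q[fun s => (xi s)%:R] = 1)%E ->
  (0 < 'V_Q[fun s => (xi s)%:R] < +oo)%E ->
  forall (d : measure_display) (Omega : measurableType d)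
    (P : probability Omega R) (X : seq nat -> {RV P >-> nat}),
  (forall u, distribution P (X u) =1 distribution Q xi) ->
  mutually_independent X ->
  forall k n : nat, (1 <= k)%N -> (1 <= n)%N ->
  (0 < P (GW_size_event X n))%E ->
  (cond_expectation P (GW_size_event X n)
     (fun w => num_pairs R k (GW_tree X w))
   <= (C (distribution Q xi) * n%:R * k%:R)%:E)%E.
Proof.
pose bound (mu : probability nat R) (C : R) :=
  forall n k, (0 < n)%N -> (0 < k)%N -> 0 < tree_mass (mass_at mu) n ->
  \sum_(e <- tree_codes n) weight (mass_at mu) e *
     (size e + \sum_(1 <= i < k) size (pairs i (k - i) e))%N%:R
  <= C * n%:R * k%:R * tree_mass (mass_at mu) n.
(* The bound only involves the distribution, so the constant can be chosen as a
   function of it, before the probability spaces. *)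
have /choice[C HC] : forall mu, exists C, (exists C', bound mu C') -> bound mu C.
  move=> mu; have [[C' HC']|no] := pselect (exists C', bound mu C').
    by exists C'.
  by exists 0.
exists C => d0 S Q xi mean1 /andP[var_gt0 var_fin] d Omega P X X_mu X_indep k n k0 n0 q0.
apply: (cond_pairs_le X_mu X_indep k0 _ q0).
apply: HC => //.
  by have [C' _ HC'] := offspring_bound mean1 var_gt0 var_fin; exists C'.
by move: q0; rewrite (size_event_prob X_mu X_indep).
Qed.
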